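(* Assume that $g$ satisfies: there is $\delta>0$ with $g(s)\ge\delta$ for all $s\in\mathbb{R}$, and $g'(s)s\ge0$ for all $s\in\mathbb{R}$; and that $f(0)=0$. Let the constants $\varepsilon_1,\varepsilon_2,\tau^*$, the problems (P) and (H), their data and solutions be as in the context. Then there exists a positive constant $\varepsilon_3\le\min\{\varepsilon_1,\varepsilon_2\}$ such that, when $$\|(u_{0x}^\tau,\hat u_{0x})\|_2+\|(v_{0x}^\tau,\hat v_{0x})\|_2\le\varepsilon_3,$$ the solutions $(u^\tau,v^\tau)$ of (P) satisfy, with respect to the asymptotic profile $(\hat u,\hat v)$ solving (H), $$\|(u^\tau-\hat u,v^\tau-\hat v)(\cdot,t)\|_{L^\infty}\le C\left(\|u_0^\tau-\hat u_0\|_1+\|v_0^\tau-\hat v_0\|_1\right)+C\tau^{-1}$$ uniformly for all time $t$, for $\tau\ge\tau^*$, where $C>0$ is a constant independent of $t$ and $\tau$. Moreover, if the initial data satisfy the additional condition $$\|u_0^\tau-\hat u_0\|_1+\|v_0^\tau-\hat v_0\|_1\le C\tau^{-1},$$ then the solutions of (P) converge to those of (H) as $\tau\to+\infty$, in the sense that $$\|(u^\tau-\hat u,v^\tau-\hat v)(\cdot,t)\|_{L^\infty}\le C\tau^{-1}\quad\text{uniformly for all time }t.$$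
   Context: $\|\cdot\|$ is the $L^2(0,1)$ norm, $\|\cdot\|_k$ the $H^k(0,1)$ norm, $L^\infty=L^\infty(0,1)$; the norm of a pair is the norm in the product space. $C$ denotes a generic positive constant that may vary from line to line. The functions $f,g:\mathbb{R}\to\mathbb{R}$ are smooth, $k>0$ is a constant, $\tau>0$ is the relaxation time, and $h(s):=g'(s)s+g(s)$. Problem (P): $$u^\tau_t+v^\tau_x=0,\quad v^\tau_t+g(u^\tau_x)u^\tau_x=\frac{f(u^\tau)-v^\tau}{\tau},\quad x\in(0,1),\ t>0,$$ with $(u^\tau,v^\tau)(x,0)=(u_0^\tau(x),v_0^\tau(x))$ and $u^\tau_x(0,t)=0$, $u^\tau_x(1,t)=-ku^\tau_t(1,t)$. The data $(u_0^\tau,v_0^\tau)\in(H^3(0,1))^2$ satisfy the compatibility conditions $u_{0x}^\tau(0)=0$, $v_{0xx}^\tau(0)=0$, $u_{0x}^\tau(1)=kv_{0x}^\tau(1)$, $v_{0xx}^\tau(1)=ku^{(2)}(1)$ with $u^{(2)}:=h(u_{0x}^\tau)u_{0xx}^\tau+\frac1\tau(v_{0x}^\tau-f'(u_0^\tau)u_{0x}^\tau)$. Constants $\varepsilon_1,\tau^*$: positive constants, $\tau^*$ independent of $t$ and $\tau$, such that if $\|u_{0x}^\tau\|_2+\|v_{0x}^\tau\|_2\le\varepsilon_1$ and $\tau\ge\tau^*$, then (P) has a unique global solution $(u^\tau,v^\tau)\in(C^0([0,\infty);H^3(0,1)))^2$, and with constants $C,\sigma>0$ independent of $t$ and $\tau$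 one has $\|u_x^\tau(\cdot,t)\|_2+\|v_x^\tau(\cdot,t)\|_2\le C(\|u_{0x}^\tau\|_2+\|v_{0x}^\tau\|_2)e^{-\sigma t}$. Profile system (L): $$\bar u_t+\bar v_x=0,\quad \bar v_t+g(\bar u_x)\bar u_x=0,\quad x\in(0,1),\ t>0,$$ with $(\bar u,\bar v)(x,0)=(\bar u_0(x),\bar v_0(x))$, $\bar u_x(0,t)=0$, $\bar u_x(1,t)=-k\bar u_t(1,t)$, where $(\bar u_0,\bar v_0)\in(H^3(0,1))^2$ satisfies $\bar u_{0x}(0)=0$, $\bar v_{0xx}(0)=0$, $\bar u_{0x}(1)=k\bar v_{0x}(1)$, $\bar v_{0xx}(1)=kh(\bar u_{0x}(1))\bar u_{0xx}(1)$. Constant $\varepsilon_2$: a positive constant such that if $\|\bar u_{0x}\|_2+\|\bar v_{0x}\|_2\le\varepsilon_2$, then (L) has a unique global solution $(\bar u,\bar v)\in(C^0([0,\infty);H^3(0,1)))^2$, and with constants $C,\gamma>0$ independent of $t$, $\|\bar u_x(\cdot,t)\|_2+\|\bar v_x(\cdot,t)\|_2\le C(\|\bar u_{0x}\|_2+\|\bar v_{0x}\|_2)e^{-\gamma t}$ and $\|(\bar u-\bar u_* )(\cdot,t)\|+\|(\bar v-\bar v_* )(\cdot,t)\|\le C(\|\bar u_{0x}\|+\|\bar v_{0x}\|)e^{-\gamma t}$, where $\bar u_*=\lim_{t\to\infty}\int_0^1\bar u\,dx$ and $\bar v_*=\lim_{t\to\infty}\int_0^1\bar v\,dx$. Shifted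 profile: $\hat u_0:=\bar u_0-\bar u_*$, $\hat v_0:=\bar v_0-\bar v_*$, and $(\hat u,\hat v):=(\bar u-\bar u_*,\bar v-\bar v_* )$, which is the unique global solution of problem (H): the system and boundary conditions of (L) with initial data $(\hat u_0,\hat v_0)$. *)

(* Defs.v *)
From HB Require Import structures.
From mathcomp Require Import all_boot all_order all_algebra.
From mathcomp Require Import all_classical all_reals all_analysis.
Set Implicit Arguments.
Unset Strict Implicit.
Unset Printing Implicit Defensive.
Import Order.TTheory GRing.Theory Num.Theory.
Import numFieldNormedType.Exports.

Local Open Scope ring_scope.
Local Open Scope classical_set_scope.

Section Sobolev.
Context {R : realType}.
Implicit Types (a b w : R -> R) (i k : nat).

Definition I01 : set R := `]0, 1[%classic.

Definition L2 w : Prop := w \_ I01 \in Lfun (@lebesgue_measure R) 2%:E.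

Definition L2norm w : R :=
  fine ('N[@lebesgue_measure R]_2%:E [EFin \o (w \_ I01)])%E.

Definition Linfnorm w : \bar R :=
  ('N[@lebesgue_measure R]_+oo [EFin \o (w \_ I01)])%E.

(* C^1_c(0,1); it defines the same weak derivatives as C^oo_c(0,1). *)
Definition test_function (phi : R -> R) : Prop :=
  [/\ forall x : R, derivable phi x 1, continuous (derive1 phi) &
      exists c d : R, [/\ 0 < c, c < d, d < 1 &
                      forall x : R, x \notin `[c, d] -> phi x = 0]].

Definition weak_derivative a b : Prop :=
  forall phi, test_function phi ->
    \int[@lebesgue_measure R]_(x in I01) (a x * derive1 phi x)
    = - \int[@lebesgue_measure R]_(x in I01) (b x * phi x).

(* A function on (0,1) is handled together with its weak derivatives: [u i] is
   d^i u / dx^i.  The derivatives of order < k of an H^k function are taken to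
   be the representatives continuous on [0,1], so that [u i 0] and [u i 1] are
   the traces; values outside [0,1] play no role. *)
Definition jet := nat -> R -> R.

Definition inH k (u : jet) : Prop :=
  [/\ forall i, (i <= k)%N -> L2 (u i),
      forall i, (i < k)%N -> weak_derivative (u i) (u i.+1) &
      forall i, (i < k)%N -> {within `[0, 1]%classic, continuous (u i)}].

Definition Hnorm k (u : jet) : R :=
  Num.sqrt (\sum_(i < k.+1) L2norm (u i) ^+ 2).

Definition dx (u : jet) : jet := fun i => u i.+1.

Definition jconst (c : R) : jet := fun i _ => if i is 0%N then c else 0.

(* norm of (u, v) in the Hilbert space H^k x H^k *)
Definition Hnorm2 k (u v : jet) : R := Num.sqrt (Hnorm k u ^+ 2 + Hnorm k v ^+ 2).

(* norm of (a, b) in L^oo x L^oo *)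
Definition Linfnorm2 a b : \bar R := Order.max (Linfnorm a) (Linfnorm b).

(* C^0([0,oo); H^3(0,1)); [u t i x] is d^i u / dx^i at (x, t) *)
Definition C0H3 (u : R -> jet) : Prop :=
  (forall t : R, 0 <= t -> inH 3 (u t)) /\
  (forall t0 : R, 0 <= t0 ->
     Hnorm 3 (u t - u t0) @[t --> within [set s : R | 0 <= s] (nbhs t0)] --> (0 : R)).

End Sobolev.
Arguments jet : clear implicits.

Section Problems.
Context {R : realType}.

Definition smooth (f : R -> R) : Prop := forall n (x : R), derivable (derive1n n f) x 1.

Definition hfun (g : R -> R) (s : R) : R := derive1 g s * s + g s.

(* Global solutions of  u_t + v_x = 0,  v_t + g(u_x) u_x = S(u, v)  with data
   (u0, v0) and u_x(0,t) = 0, u_x(1,t) = - k u_t(1,t), in C^0([0,oo); H^3)^2.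
   Since H^3 embeds in C^2([0,1]), u_x, v_x are continuous in (x, t) and the
   equations hold classically. *)
Definition global_solution (S : R -> R -> R) (g : R -> R) (k : R)
    (u0 v0 : jet R) (u v : R -> jet R) : Prop :=
  [/\ C0H3 u, C0H3 v,
      forall t x : R, 0 < t -> 0 < x < 1 ->
        is_derive t 1 (fun s => u s 0%N x) (- v t 1%N x) /\
        is_derive t 1 (fun s => v s 0%N x)
          (S (u t 0%N x) (v t 0%N x) - g (u t 1%N x) * u t 1%N x),
      forall x : R, 0 <= x <= 1 -> u 0 0%N x = u0 0%N x /\ v 0 0%N x = v0 0%N x &
      forall t : R, 0 < t ->
        [/\ u t 1%N 0 = 0,
            derivable (fun s => u s 0%N 1) t 1 &
            u t 1%N 1 = - k * derive1 (fun s => u s 0%N 1) t]].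

Definition unique_global_solution (S : R -> R -> R) (g : R -> R) (k : R)
    (u0 v0 : jet R) (u v : R -> jet R) : Prop :=
  global_solution S g k u0 v0 u v /\
  forall u' v', global_solution S g k u0 v0 u' v' ->
    forall t x : R, 0 <= t -> 0 <= x <= 1 ->
      u' t 0%N x = u t 0%N x /\ v' t 0%N x = v t 0%N x.

Definition relaxation (f : R -> R) (tau a b : R) : R := (f a - b) / tau.

Definition no_source (a b : R) : R := 0.

Definition P_data (f g : R -> R) (k tau : R) (u0 v0 : jet R) : Prop :=
  let u2 x := hfun g (u0 1%N x) * u0 2%N x
              + tau^-1 * (v0 1%N x - derive1 f (u0 0%N x) * u0 1%N x) in
  [/\ inH 3 u0 /\ inH 3 v0, u0 1%N 0 = 0, v0 2%N 0 = 0,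
      u0 1%N 1 = k * v0 1%N 1 & v0 2%N 1 = k * u2 1].

Definition P_solution (f g : R -> R) (k tau : R) (u0 v0 : jet R)
    (u v : R -> jet R) : Prop :=
  global_solution (relaxation f tau) g k u0 v0 u v.

Definition L_data (g : R -> R) (k : R) (u0 v0 : jet R) : Prop :=
  [/\ inH 3 u0 /\ inH 3 v0, u0 1%N 0 = 0, v0 2%N 0 = 0,
      u0 1%N 1 = k * v0 1%N 1 &
      v0 2%N 1 = k * hfun g (u0 1%N 1) * u0 2%N 1].

Definition L_solution (g : R -> R) (k : R) (u0 v0 : jet R)
    (u v : R -> jet R) : Prop :=
  global_solution no_source g k u0 v0 u v.

Definition mean_limit (u : R -> jet R) (c : R) : Prop :=
  (\int[@lebesgue_measure R]_(x in I01) u t 0%N x) @[t --> +oo] --> c.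

(* [eps1] and [taus] are admissible constants for (P): global well-posedness
   and uniform exponential decay for tau >= taus and eps1-small data. *)
Definition P_constants (f g : R -> R) (k eps1 taus : R) : Prop :=
  0 < eps1 /\ 0 < taus /\
  exists C sigma : R, 0 < C /\ 0 < sigma /\
    forall tau u0 v0, taus <= tau -> P_data f g k tau u0 v0 ->
      Hnorm 2 (dx u0) + Hnorm 2 (dx v0) <= eps1 ->
      exists u v,
        unique_global_solution (relaxation f tau) g k u0 v0 u v /\
        forall t : R, 0 <= t ->
          Hnorm 2 (dx (u t)) + Hnorm 2 (dx (v t))
          <= C * (Hnorm 2 (dx u0) + Hnorm 2 (dx v0)) * expR (- sigma * t).

(* [eps2] is an admissible constant for (L). *)
Definition L_constant (g : R -> R) (k eps2 : R) : Prop :=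
  0 < eps2 /\
  exists C gamma : R, 0 < C /\ 0 < gamma /\
    forall u0 v0, L_data g k u0 v0 ->
      Hnorm 2 (dx u0) + Hnorm 2 (dx v0) <= eps2 ->
      exists u v,
        [/\ unique_global_solution no_source g k u0 v0 u v,
            forall t : R, 0 <= t ->
              Hnorm 2 (dx (u t)) + Hnorm 2 (dx (v t))
              <= C * (Hnorm 2 (dx u0) + Hnorm 2 (dx v0)) * expR (- gamma * t) &
            exists ustar vstar : R,
              [/\ mean_limit u ustar, mean_limit v vstar &
                  forall t : R, 0 <= t ->
                    Hnorm 0 (u t - jconst ustar) + Hnorm 0 (v t - jconst vstar)
                    <= C * (Hnorm 0 (dx u0) + Hnorm 0 (dx v0))
                       * expR (- gamma * t)]].

(* The shifted profile (uh, vh), with its data (uh0, vh0): a solution of (L)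
   minus the limits of its means; it solves (H). *)
Definition shifted_profile (g : R -> R) (k : R) (uh0 vh0 : jet R) (uh vh : R -> jet R) : Prop :=
  exists u0 v0 u v ustar vstar,
    [/\ L_data g k u0 v0, L_solution g k u0 v0 u v,
        mean_limit u ustar /\ mean_limit v vstar,
        uh0 = u0 - jconst ustar /\ vh0 = v0 - jconst vstar &
        uh = (fun t => u t - jconst ustar) /\
        vh = (fun t => v t - jconst vstar)].

End Problems.

(* Main.v *)
(* Write p = (u - uh)_x, q = (v - vh)_x, a = h(u_x) and m = e^(-mu t).  Then
   p_t = - q_x and q_t = - a p_x + r with |r| <= C m (1/tau + |p|), p(0) = 0 and
   p(1) = k q(1).  Since a >= delta and the boundary is dissipative, the energy
   int q^2/2 + a p^2/2 - kp x p q, with a small multiplier kp, is bounded by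
   C (D + 1/tau)^2 e^(-nu t), where D is the H^1 distance of the data.  So the mean
   of u - uh stays O(D + 1/tau).  The mean of v - vh satisfies an ODE with damping
   1/tau, which absorbs f(u)/tau as long as |f(s)| <= M |s| for all s.
   This linear growth, needed because u itself is not assumed small, follows from
   the decay for (P) being uniform in the data: near a constant state u = A,
   integrating v_t in time bounds |f'(A)| independently of A. *)

Require Import Defs.
From HB Require Import structures.
From mathcomp Require Import all_boot all_order all_algebra.
From mathcomp Require Import all_classical all_reals all_analysis.
From mathcomp Require Import measurable_realfun ess_sup_inf ring lra.
Import Order.TTheory GRing.Theory Num.Theory.
Import numFieldNormedType.Exports.
Local Open Scope ring_scope.
Local Open Scope classical_set_scope.
Set Implicit Arguments.
Unset Strict Implicit.
Unset Printing Implicit Defensive.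

(** * Integration on (0,1) *)

(** Smallness of the data serves only to make the decay statements for (P) and (L) available. The
    lower-order coefficients of the difference equation need not be small: they are bounded by a
    multiple of m, hence integrable over all times, and cost a fixed factor in Gronwall's
    inequality. So [eps3] can be the minimum of [eps1] and [eps2].

    The energy sits at the level of u_x and v_x and involves only two derivatives of u and v, which
    are continuous for H^3 functions; its identity is therefore pointwise. The notion of solution
    postulates neither equations for u_xt and v_xt nor u_x = k v_x at x = 1: these are derived from
    the first-order equations by estimating increments.

    The damping of the mean of v degenerates as tau grows. But f(u)/tau carries the same factor
    1/tau, so the level at which the two balance is independent of tau; the remaining forcing is
    integrable in time.

    For the growth of f, uniformity in A holds because the smallness condition sees only derivatives
    of the data. The size eta of the perturbation depends on A, but it cancels in the resulting
    inequality. *)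

Section Integration.
Context {R : realType}.
Implicit Types (a b w : R -> R) (x y z : R).
Notation mu := (@lebesgue_measure R).
Notation I := (@I01 R).

Lemma I01P x : I x <-> 0 < x < 1.
Proof. by rewrite /I01 /= in_itv. Qed.

Lemma measurable_I01 : measurable (I : set (measurableTypeR R)).
Proof. exact: measurable_itv. Qed.
Hint Resolve measurable_I01 : core.

Lemma integrable_I01_closed w :
  mu.-integrable `[0, 1]%classic (EFin \o w) -> mu.-integrable I (EFin \o w).
Proof.
by move=> iw; apply: integrableS iw => //; exact: subset_itv_oo_cc.
Qed.

Lemma within_integrable w :
  {within `[0, 1]%classic, continuous w} -> mu.-integrable I (EFin \o w).
Proof.
move=> cw; apply: integrable_I01_closed.
by apply: continuous_compact_integrable => //; exact: segment_compact.
Qed.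

Lemma continuous_integrable w : continuous w -> mu.-integrable I (EFin \o w).
Proof. by move=> cw; apply/within_integrable/continuous_subspaceT. Qed.

Lemma Rintegral_I01_cst c : \int[mu]_(x in I) (fun=> c) x = c.
Proof.
have muI := lebesgue_measure_itv (Interval (BRight (0 : R)) (BLeft 1)).
rewrite /= lte_fin ltr01 sube0 in muI.
rewrite Rintegral_cst // -[RHS]mulr1; congr (_ * _); exact: (congr1 fine muI).
Qed.

Lemma FTC_I01 (F w : R -> R) : continuous F -> continuous w ->
  (forall x, 0 < x < 1 -> is_derive x 1 F (w x)) ->
  \int[mu]_(x in I) w x = F 1 - F 0.
Proof.
move=> cF cw dF.
rewrite /I01 Rintegral_itv_bndo_bndc; last exact: continuous_integrable.
have icc : mu.-integrable `[0, 1]%classic (EFin \o w).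
  apply: continuous_compact_integrable; first exact: segment_compact.
  exact: continuous_subspaceT.
rewrite Rintegral_itv_obnd_cbnd; last first.
  by apply: integrableS icc => //; exact: subset_itv_oc_cc.
rewrite /Rintegral (@continuous_FTC2 _ _ F) ?ltr01 //.
- exact: continuous_subspaceT.
- split; first by move=> x; rewrite in_itv /= => /dF [].
  + by apply: cvg_at_right_filter; exact: cF.
  + by apply: cvg_at_left_filter; exact: cF.
- move=> x; rewrite in_itv /= => xI; have [dFx <-] := dF x xI.
  by rewrite derive1E.
Qed.

Lemma L2_measurable w : L2 w -> measurable_fun I w.
Proof.
move=> /sub_Lfun_mfun; rewrite inE /= => mw.
by apply/(measurable_restrictT w measurable_I01).
Qed.

Lemma L2_sqr_integrable w : L2 w -> mu.-integrable I (EFin \o (fun x => w x ^+ 2)).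
Proof.
move=> /Lfun2_integrable_sqr iw.
have [_] := @integrable_mkcond _ _ _ mu _ (EFin \o (fun x => w x ^+ 2)) measurable_I01.
apply.
rewrite [X in mu.-integrable _ X](_ : _ = EFin \o (fun x => (w \_ I) x ^+ 2)) //.
apply/funext => x /=; rewrite /patch; case: ifPn => // _.
by rewrite expr0n.
Qed.

Lemma L2norm_ge0 w : 0 <= L2norm w.
Proof. by rewrite /L2norm fine_ge0 // Lnorm_ge0. Qed.

Lemma L2normE w : L2norm w ^+ 2 = \int[mu]_(x in I) (w x ^+ 2).
Proof.
rewrite -powR_mulrn ?L2norm_ge0 // /L2norm -fine_poweR poweR_Lnorm //.
rewrite Rintegral_mkcond /Rintegral; congr fine; apply: eq_integral => x _ /=.
rewrite /patch; case: ifPn => _; rewrite powR_mulrn //.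
  by rewrite real_normK ?num_real.
by rewrite normr0 expr0n.
Qed.

Lemma L2B a b : L2 a -> L2 b -> L2 (a - b).
Proof.
rewrite /L2 => la lb; have -> : (a - b) \_ I = a \_ I - b \_ I.
  by apply/funext => x; rewrite /patch !fctE; case: ifPn => //; rewrite subr0.
by apply: (Lfun_addr_closed _ (lee1n 2)).2 => //; exact: Lfun_oppr_closed.
Qed.
End Integration.

(** * Square-integrable functions on an interval of unit length *)

Section Inequalities.
Context {R : realType}.
Implicit Types (a b w : R -> R) (x y z : R).
Notation mu := (@lebesgue_measure R).
Notation I := (@I01 R).
Local Hint Resolve measurable_I01 : core.

(** From [|w| <= w ^+ 2 + 1], since (0,1) has finite measure. *)
Lemma L2_integrable w : L2 w -> mu.-integrable I (EFin \o w).
Proof.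
move=> l2; have iw := L2_sqr_integrable l2.
have i1 : mu.-integrable I (EFin \o cst 1).
  by apply: continuous_integrable; exact: cst_continuous.
apply: (@le_integrable _ _ _ mu _ measurable_I01 _
    (EFin \o (fun x => w x ^+ 2 + 1))).
- by apply/measurable_EFinP; exact: L2_measurable.
- move=> x _ /=; rewrite lee_fin [leRHS]ger0_norm ?addr_ge0 ?sqr_ge0 //.
  rewrite ler_norml; have := sqr_ge0 (w x - 1); have := sqr_ge0 (w x + 1).
  by move=> h1 h2; nra.
- have -> : EFin \o (fun x => w x ^+ 2 + 1) =
      (EFin \o (fun x => w x ^+ 2)) \+ (EFin \o cst 1) by [].
  exact: (integrableD measurable_I01 iw i1).
Qed.

Lemma integrable_mulcont w (phi : R -> R) : mu.-integrable I (EFin \o w) ->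
  continuous phi -> mu.-integrable I (EFin \o (fun x => w x * phi x)).
Proof.
move=> iw cphi.
apply: (integrableMl measurable_I01 iw).
- have ip := continuous_integrable cphi.
  by have /integrableP[/measurable_EFinP] := ip.
- have : compact (phi @` `[0, 1]%classic).
    by apply: continuous_compact; [exact: continuous_subspaceT|exact: segment_compact].
  move=> /compact_bounded [M [Mr hM]]; exists M; split => // M' MM' x Ix.
  by apply: (hM _ MM'); exists x => //; exact: subset_itv_oo_cc.
Qed.

Lemma integrable_norm w : mu.-integrable I (EFin \o w) ->
  mu.-integrable I (EFin \o (fun x => `|w x|)).
Proof. by move=> /integrable_norm. Qed.

(** Jensen's inequality, by expanding the integral of [(w - c) ^+ 2 >= 0] with [c] the mean of [w];
    (0,1) has mass one. *)
Lemma Rintegral_sqr_ge w : mu.-integrable I (EFin \o w) ->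
  mu.-integrable I (EFin \o (fun x => w x ^+ 2)) ->
  (\int[mu]_(x in I) w x) ^+ 2 <= \int[mu]_(x in I) (w x ^+ 2).
Proof.
move=> iw iw2; set c := \int[mu]_(x in I) w x.
have ic d : mu.-integrable I (EFin \o cst d).
  by apply: continuous_integrable; exact: cst_continuous.
have iz : mu.-integrable I (EFin \o (fun x => (2 * c) * w x)).
  have -> : EFin \o (fun x => (2 * c) * w x) =
     (fun x => (2 * c)%:E * (EFin \o w) x)%E by apply/funext => x.
  exact: (integrableZl measurable_I01 _ iw).
have h : 0 <= \int[mu]_(x in I) (w x ^+ 2 - (2 * c * w x - cst (c ^+ 2) x)).
  apply: Rintegral_ge0 => x _ /=.
  by have := sqr_ge0 (w x - c); nra.
rewrite RintegralB // in h; last first.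
  exact: (integrableB measurable_I01 iz (ic (c ^+ 2))).
rewrite RintegralB // RintegralZl // Rintegral_I01_cst -/c in h.
nra.
Qed.

Lemma L1_le_L2norm w : L2 w -> \int[mu]_(x in I) `|w x| <= L2norm w.
Proof.
move=> l2; have iw := integrable_norm (L2_integrable l2).
have iw2 := L2_sqr_integrable l2.
rewrite -(@ler_pXn2r _ 2) ?nnegrE ?L2norm_ge0 ?Rintegral_ge0 //.
rewrite L2normE.
have h := @Rintegral_sqr_ge (fun x => `|w x|) iw.
apply: le_trans (h _) _; last by under eq_Rintegral do rewrite real_normK ?num_real //.
by rewrite (_ : EFin \o _ = EFin \o (fun x => w x ^+ 2)) //; apply/funext => x /=;
  rewrite real_normK ?num_real.
Qed.

Lemma L2norm_ge w d : L2 w -> (forall x, 0 < x < 1 -> d <= `|w x|) -> d <= L2norm w.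
Proof.
move=> l2 dw; apply: le_trans (L1_le_L2norm l2).
rewrite -[leLHS](@Rintegral_I01_cst R); apply: le_Rintegral => //.
  by apply: continuous_integrable; exact: cst_continuous.
exact/integrable_norm/L2_integrable.
Qed.

Lemma within_L2 w : {within `[0, 1]%classic, continuous w} -> L2 w.
Proof.
move=> cw.
have cw2 : {within `[0, 1]%classic, continuous (fun x => w x * w x)}.
  by move=> x; apply: continuousM; exact: cw.
have iw := within_integrable cw; have iw2 := within_integrable cw2.
have mw : measurable_fun [set: R] (w \_ I).
  apply/(measurable_restrictT w measurable_I01).
  by have /integrableP[/measurable_EFinP] := iw.
rewrite /L2 inE; apply/andP; split; rewrite inE //=.
rewrite /finite_norm.
apply: (@lty_poweRy _ _ 2) => //; rewrite poweR_Lnorm //.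
have /integrableP[_] := iw2; rewrite [X in (X < _)%E]integral_mkcond.
apply: le_lt_trans; rewrite le_eqVlt; apply/orP; left; apply/eqP.
apply: eq_integral => x _ /=.
rewrite /patch; case: ifPn => _ /=; rewrite powR_mulrn //.
  by rewrite -expr2 normrX.
by rewrite normr0 expr0n.
Qed.

End Inequalities.

(** * Continuity of arithmetic combinations *)

Section Continuity.
Context {R : realType} {T : topologicalType}.
Implicit Types f g : T -> R.

Lemma contD f g : continuous f -> continuous g -> continuous (fun x => f x + g x).
Proof. by move=> cf cg x; apply: continuousD; [exact: cf|exact: cg]. Qed.

Lemma contN f : continuous f -> continuous (fun x => - f x).
Proof. by move=> cf x; apply: continuousN; exact: cf. Qed.

Lemma contM f g : continuous f -> continuous g -> continuous (fun x => f x * g x).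
Proof. by move=> cf cg x; apply: continuousM; [exact: cf|exact: cg]. Qed.

Lemma contX f n : continuous f -> continuous (fun x => f x ^+ n).
Proof.
move=> cf; elim: n => [|n IHn]; first exact: cst_continuous.
rewrite (_ : (fun x => _) = (fun x => f x * f x ^+ n)); first exact: contM.
by apply/funext => x; rewrite exprS.
Qed.

Lemma cont_cst (c : R) : continuous (fun _ : T => c).
Proof. exact: cst_continuous. Qed.

Lemma cont_comp (F : R -> R) f : continuous F -> continuous f -> continuous (fun x => F (f x)).
Proof. by move=> cF cf x; apply: continuous_comp; [exact: cf|exact: cF]. Qed.

End Continuity.

(** * Derivatives in terms of increments *)

Section Derivatives.
Context {R : realType}.
Implicit Types (F G : R -> R) (x y z d : R).

(** Increment form of differentiability; the non-strict bound also covers [h = 0]. In this form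
    derivatives can be obtained from mean value estimates. *)
Lemma is_derive_epsP F z d : is_derive z 1 F d <->
  forall e, 0 < e -> exists2 r, 0 < r &
    forall h, `|h| < r -> `|F (z + h) - F z - d * h| <= e * `|h|.
Proof.
have quot h : h != 0 -> `|F (z + h) - F z - d * h| =
    `|d - h^-1 *: (F (h *: 1 + z) - F z)| * `|h|.
  move=> h0; rewrite -normrM -normrN; congr (`|_|); rewrite /GRing.scale /= mulr1 (addrC h z).
  by field.
split=> [[dF vF] e e0|H].
- have : h^-1 *: (F (h *: 1 + z) - F z) @[h --> 0^'] --> d by rewrite -vF; exact: dF.
  move=> /cvgrPdist_le /(_ e e0) [r /= r0 hr]; exists r => // h hh.
  have [->|h0] := eqVneq h 0; first by rewrite addr0 subrr mulr0 subr0 normr0 mulr0.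
  rewrite quot // ler_pM2r ?normr_gt0 //; apply: hr => //=.
  by rewrite sub0r normrN.
- have c : h^-1 *: (F (h *: 1 + z) - F z) @[h --> 0^'] --> d.
    apply/cvgrPdist_le => e e0; have [r r0 hr] := H e e0; exists r => // h /=.
    rewrite sub0r normrN => hh h0.
    by have := hr h hh; rewrite quot // ler_pM2r ?normr_gt0.
  apply: DeriveDef; first by apply/cvg_ex; exists d; exact: c.
  by apply/cvg_lim.
Qed.

Lemma is_derive_lip F z d c r : is_derive z 1 F d -> 0 < r -> 
  (forall h, `|h| < r -> `|F (z + h) - F z| <= c * `|h|) -> `|d| <= c.
Proof.
move=> /is_derive_epsP dF r0 lip; apply/ler_addgt0Pr => e e0.
have [s s0 hs] := dF e e0.
pose h := Num.min r s / 2.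
have m0 : 0 < Num.min r s by rewrite lt_min r0 s0.
have h0 : 0 < h by rewrite /h divr_gt0.
have [hr hs'] : h < r /\ h < s.
  by rewrite /h; split; move: m0; case: (leP r s) => ? ?; lra.
have nh : `|h| = h by rewrite gtr0_norm.
have := lip h; have := hs h; rewrite nh => /(_ hs') A /(_ hr) B.
rewrite -(ler_pM2r h0) -{1}nh -normrM.
have -> : d * h = (F (z + h) - F z) - (F (z + h) - F z - d * h) by ring.
by apply: le_trans (ler_normB _ _) _; rewrite mulrDl lerD.
Qed.

Lemma is_derive_near F G z d r : 0 < r -> (forall y, `|y - z| < r -> F y = G y) ->
  is_derive z 1 F d -> is_derive z 1 G d.
Proof.
move=> r0 FG /is_derive_epsP dF; apply/is_derive_epsP => e /dF [s s0 hs].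
exists (Num.min r s) => [|h]; first by rewrite lt_min r0 s0.
rewrite lt_min => /andP[hr hs']; rewrite -!FG ?hs //.
- by rewrite subrr normr0.
- by rewrite addrC addKr.
Qed.

Lemma derivable_is_derive F z : derivable F z 1 -> is_derive z 1 F (derive1 F z).
Proof. by move=> dF; rewrite derive1E; exact: derivableP. Qed.

Lemma is_derive_derive1 F z d : is_derive z 1 F d -> derive1 F z = d.
Proof. by move=> [_ <-]; rewrite derive1E. Qed.

Lemma is_derive_unique F z d1 d2 : is_derive z 1 F d1 -> is_derive z 1 F d2 -> d1 = d2.
Proof. by move=> [_ <-] [_ <-]. Qed.

Lemma is_derive_continuous F z d : is_derive z 1 F d -> {for z, continuous F}.
Proof. by move=> [dF _]; apply/differentiable_continuous/derivable1_diffP. Qed.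

End Derivatives.

(** * Mixed derivatives and differentiation under the integral sign *)

Section TimeDerivatives.
Context {R : realType}.
Implicit Types (F G Y : R -> R) (A B : R -> R -> R) (s t x y z : R).
Notation mu := (@lebesgue_measure R).
Notation I := (@I01 R).
Local Hint Resolve measurable_I01 : core.

Lemma le_increment F (dF : R -> R) z k c :
  (forall y, `|y - z| <= `|k| -> is_derive y 1 F (dF y)) ->
  (forall y, `|y - z| <= `|k| -> `|dF y| <= c) -> `|F (z + k) - F z| <= c * `|k|.
Proof.
move=> hd hc; have [k0|k0|->] := ltgtP k 0; last first.
- by rewrite addr0 subrr normr0 mulr0.
- have [|||y] := @MVT R F dF z (z + k).
  + by lra.
  + move=> y; rewrite in_itv /= => /andP[h1 h2]; apply: hd.
    by rewrite gtr0_norm ?(gtr0_norm k0); lra.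
  + apply: derivable_within_continuous => y; rewrite in_itv /= => /andP[h1 h2].
    have [] // := hd y _.
    by rewrite ger0_norm ?(gtr0_norm k0); lra.
  + rewrite in_itv /= => /andP[h1 h2] ->; rewrite addrC addKr normrM.
    apply: ler_wpM2r => //; apply: hc.
    by rewrite gtr0_norm ?(gtr0_norm k0); lra.
- have [|||y] := @MVT R F dF (z + k) z.
  + by lra.
  + move=> y; rewrite in_itv /= => /andP[h1 h2]; apply: hd.
    by rewrite ltr0_norm ?(ltr0_norm k0); lra.
  + apply: derivable_within_continuous => y; rewrite in_itv /= => /andP[h1 h2].
    have [] // := hd y _.
    by rewrite ler0_norm ?(ltr0_norm k0); lra.
  + rewrite in_itv /= => /andP[h1 h2]; rewrite distrC => ->.
    have -> : z - (z + k) = - k by ring.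
    rewrite normrM normrN; apply: ler_wpM2r => //; apply: hc.
    by rewrite ltr0_norm ?(ltr0_norm k0); lra.
Qed.

Lemma continuous_eps2 (A : R * R -> R) t x : {for (t, x), continuous A} ->
  forall e, 0 < e -> exists2 r, 0 < r &
    forall s y, `|s - t| < r -> `|y - x| < r -> `|A (s, y) - A (t, x)| <= e.
Proof.
move=> cA e e0; have /cvgrPdist_le /(_ e e0) := cA.
move=> [[P Q] /= [[r r0 hr] [r' r'0 hr']] PQ].
exists (Num.min r r') => [|s y]; first by rewrite lt_min r0 r'0.
rewrite !lt_min => /andP[sr _] /andP[_ yr].
rewrite distrC; apply: (PQ (s, y)); split => /=.
- by apply: hr; rewrite /= distrC.
- by apply: hr'; rewrite /= distrC.
Qed.

(** Schwarz's argument with continuity of [Bx] at the single point: the mixed second difference is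
    estimated by the mean value theorem in time and then in space. It supplies the time derivatives
    of u_x and v_x, which the notion of solution does not mention. *)
Lemma mixed_derivative (A B Ax Bx : R -> R -> R) t x r : 0 < r ->
  (forall s y, `|s - t| < r -> `|y - x| < r ->
    [/\ is_derive s 1 (A ^~ y) (B s y), is_derive y 1 (A s) (Ax s y) &
        is_derive y 1 (B s) (Bx s y)]) ->
  {for (t, x), continuous (fun z : R * R => Bx z.1 z.2)} ->
  is_derive t 1 (Ax ^~ x) (Bx t x).
Proof.
move=> r0 H cB; apply/is_derive_epsP => e e0.
have [q q0 hq] := continuous_eps2 cB e0.
exists (Num.min r q) => [|h]; first by rewrite lt_min r0 q0.
rewrite lt_min => /andP[hr hq'].
set b := Bx t x.
(* The quantity to be estimated is the derivative of [D] at [x]; it is bounded by the local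
   Lipschitz constant [e * |h|] of [D] there. *)
pose D y := A (t + h) y - A t y - (b * h) * y.
have dD : is_derive x 1 D (Ax (t + h) x - Ax t x - b * h).
  have [||_ d1 _] := H (t + h) x; first by rewrite addrC addKr.
    by rewrite subrr normr0.
  have [||_ d2 _] := H t x; try by rewrite subrr normr0.
  apply: is_derive_eq; rewrite /GRing.scale /=; ring.
apply: (@is_derive_lip R D x _ _ (Num.min r q) dD); first by rewrite lt_min r0 q0.
move=> k; rewrite lt_min => /andP[kr kq].
pose phi s := A s (x + k) - A s x - (b * k) * s.
have -> : D (x + k) - D x = phi (t + h) - phi t by rewrite /D /phi; ring.
rewrite mulrAC.
apply: (@le_increment phi (fun s => B s (x + k) - B s x - b * k)) => s sh.
  have sr : `|s - t| < r by apply: le_lt_trans hr.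
  have [//||d1 _ _] := H s (x + k); first by rewrite addrC addKr.
  have [//||d2 _ _] := H s x; first by rewrite subrr normr0.
  apply: is_derive_eq; rewrite /GRing.scale /=; ring.
have sr : `|s - t| < r by apply: le_lt_trans hr.
have sq : `|s - t| < q by apply: le_lt_trans hq'.
have -> : B s (x + k) - B s x - b * k = 
   (B s (x + k) - b * (x + k)) - (B s x - b * x) by ring.
apply: (@le_increment (fun y => B s y - b * y) (fun y => Bx s y - b)) => y yk.
  have [//||_ _ d1] := H s y; first exact: le_lt_trans kr.
  apply: is_derive_eq; rewrite /GRing.scale /=; ring.
by apply: hq => //; exact: le_lt_trans kq.
Qed.

Lemma continuous_slice2 (A : R * R -> R) t : continuous A ->
  continuous (fun x => A (t, x)).
Proof.
move=> cA x; apply: (@continuous_comp _ _ _ (fun x => (t, x)) A); last exact: cA.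
by apply: (@cvg_pair _ _ _ (nbhs x) (nbhs t) (nbhs x)); [exact: cvg_cst|exact: cvg_id].
Qed.

Lemma continuous_slice1 (A : R * R -> R) x : continuous A ->
  continuous (fun t => A (t, x)).
Proof.
move=> cA t; apply: (@continuous_comp _ _ _ (fun t => (t, x)) A); last exact: cA.
by apply: (@cvg_pair _ _ _ (nbhs t) (nbhs t) (nbhs x)); [exact: cvg_id|exact: cvg_cst].
Qed.

Lemma bounded_rectangle (A : R * R -> R) (a b : R) : continuous A ->
  exists2 K, 0 <= K & forall t x, a <= t <= b -> 0 <= x <= 1 -> `|A (t, x)| <= K.
Proof.
move=> cA; pose Q : set (R * R) := (`[a, b]%classic `*` `[0, 1]%classic).
have cR : compact Q.
  by apply: compact_setX; exact: segment_compact.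
have /compact_bounded [M [_ hM]] : compact (A @` Q).
  by apply: continuous_compact cR; exact: continuous_subspaceT.
exists (`|M| + 1) => [|t x tab x01]; first by rewrite addr_ge0.
apply: (hM (`|M| + 1)); first by have := ler_norm M; lra.
by exists (t, x) => //; split; rewrite /= in_itv.
Qed.

Lemma continuous_integral A : continuous (fun z : R * R => A z.1 z.2) ->
  continuous (fun t => \int[mu]_(x in I) A t x).
Proof.
move=> cA t; have [K K0 hK] := bounded_rectangle (t - 1) (t + 1) cA.
have ti : t \in `]t - 1, t + 1[%classic by rewrite inE /= in_itv /=; lra.
apply: (@continuity_under_integral R _ _ mu A I measurable_I01 (t - 1) (t + 1) _ _
  (cst K) _ _ t ti) => //=.
- by move=> s _; apply: continuous_integrable; exact: (continuous_slice2 cA).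
- by apply: aeW => x Ix s _; exact: (continuous_slice1 cA).
- by apply: continuous_integrable; exact: cst_continuous.
- move=> s sI; apply: aeW => x /I01P Ix; apply: (hK s x).
    by move: sI; rewrite in_itv /=; lra.
  by lra.
Qed.

(** Dominated by a bound of [B] on the compact rectangle of times [[0, t + 1]] and points [[0, 1]].
    Times are taken in an interval open at 0 because the equations hold for positive times only. *)
Lemma is_derive_integral A B t : 0 < t ->
  continuous (fun z : R * R => A z.1 z.2) -> continuous (fun z : R * R => B z.1 z.2) ->
  (forall t x, 0 < t -> 0 < x < 1 -> is_derive t 1 (A ^~ x) (B t x)) ->
  is_derive t 1 (fun t => \int[mu]_(x in I) A t x) (\int[mu]_(x in I) B t x).
Proof.
move=> t0 cA cB dA; have [K K0 hK] := bounded_rectangle 0 (t + 1) cB.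
have ti : (`]0, t + 1[%classic : set R) t by rewrite /= in_itv /=; lra.
have intA s : (`]0, t + 1[%classic : set R) s -> mu.-integrable I (EFin \o A s).
  by move=> _; apply: continuous_integrable; exact: (continuous_slice2 cA).
have dA' s x : (`]0, t + 1[%classic : set R) s -> I x -> derivable (A ^~ x) s 1.
  by rewrite /= in_itv /= => /andP[s0 _] /I01P Ix; have [] := dA s x s0 Ix.
have pE s x : 0 < s -> I x -> partial1of2 A s x = B s x.
  by move=> s0 /I01P Ix; apply: is_derive_derive1; exact: dA.
have intK : mu.-integrable I (EFin \o cst K).
  by apply: continuous_integrable; exact: cst_continuous.
have hG s x : (`]0, t + 1[%classic : set R) s -> I x -> `|partial1of2 A s x| <= cst K x.
  rewrite /= in_itv /= => /andP[s0 s1] Ix; rewrite pE //; move/I01P : Ix => Ix.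
  by apply: (hK s x); lra.
have D1 := @derivable_under_integral R _ _ mu A I measurable_I01 t 0 (t + 1) ti intA
  dA' (cst K) (fun=> K0) intK hG.
have := @differentiation_under_integral R _ _ mu A I measurable_I01 t 0 (t + 1) ti intA
  dA' (cst K) (fun=> K0) intK hG.
move=> D2; apply: DeriveDef => //; rewrite -derive1E D2.
by apply: eq_Rintegral => x /set_mem Ix; rewrite pE.
Qed.

Lemma nonincreasing_itv Y (dY : R -> R) t : continuous Y -> 0 <= t ->
  (forall s, 0 < s < t -> is_derive s 1 Y (dY s)) -> (forall s, 0 < s < t -> dY s <= 0) ->
  Y t <= Y 0.
Proof.
move=> cY; rewrite le_eqVlt => /predU1P[<- //|t0] hd hle.
have [|y] := @MVT R Y dY 0 t t0; first exact: continuous_subspaceT.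
rewrite in_itv /= => yt e; have := hle y yt; have := e.
by nra.
Qed.

Lemma nonincreasing_from0 Y (dY : R -> R) : continuous Y ->
  (forall t, 0 < t -> is_derive t 1 Y (dY t)) -> (forall t, 0 < t -> dY t <= 0) ->
  forall t, 0 <= t -> Y t <= Y 0.
Proof.
move=> cY hd hle t t0; apply: (nonincreasing_itv (dY := dY)) => // s /andP[s0 _].
  exact: hd.
exact: hle.
Qed.

End TimeDerivatives.

(** * Differential inequalities with exponentially decaying coefficients *)

Section Gronwall.
Context {R : realType}.
Implicit Types (Y E dE : R -> R) (t nu m : R).

Lemma is_derive_expR_lin (c t : R) :
  is_derive t 1 (fun s => expR (c * s)) (c * expR (c * t)).
Proof.
have h1 : is_derive t 1 (fun s : R => c * s) c.
  by apply: is_derive_eq; rewrite /GRing.scale /= mulr1.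
have h2 := @is_derive1_comp R expR (fun s => c * s) t _ _ (is_derive_expR (c * t)) h1.
by apply: (is_derive_eq h2); rewrite mulrC.
Qed.

Lemma continuous_expR_lin (c : R) : continuous (fun s : R => expR (c * s)).
Proof. by move=> t; exact: is_derive_continuous (is_derive_expR_lin c t). Qed.

(** The bound does not depend on [lam]. It serves with [lam = 0] for the mean of u - uh, and with
    [lam = 1/tau] for the mean of v - vh, where it has to survive [lam] tending to 0. *)
Lemma barrier Y (dY : R -> R) (lam a b nu : R) :
  0 <= lam -> 0 <= a -> 0 <= b -> 0 < nu -> continuous Y ->
  (forall t, 0 < t -> is_derive t 1 Y (dY t)) ->
  (forall t, 0 < t -> `|dY t + lam * Y t| <= lam * a + b * expR (- nu * t)) ->
  forall t, 0 <= t -> `|Y t| <= `|Y 0| + a + b / nu.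
Proof.
move=> lam0 a0 b0 nu0.
suff H (Z dZ : R -> R) : continuous Z ->
    (forall t, 0 < t -> is_derive t 1 Z (dZ t)) ->
    (forall t, 0 < t -> dZ t + lam * Z t <= lam * a + b * expR (- nu * t)) ->
    forall t, 0 <= t -> Z t <= `|Z 0| + a + b / nu.
  move=> cY hd hle t t0; rewrite ler_norml; apply/andP; split.
    rewrite lerNl -normrN; apply: (H (fun s => - Y s) (fun s => - dY s)) => //.
    + by move=> s; apply: continuousN; exact: cY.
    + by move=> s s0; have hs := hd s s0; exact: is_deriveN.
    + move=> s s0; have := hle s s0; rewrite ler_norml => /andP[h _].
      by rewrite mulrN -opprD lerNl.
  apply: (H Y dY) => // s s0; have := hle s s0.
  by rewrite ler_norml => /andP[_].
move=> cZ hd hle t t0.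
(* Supersolution: its derivative is [b * expR (- nu * s)], and [a <= B s] makes [lam * B s] dominate
   [lam * a]. *)
pose B (s : R) : R := `|Z 0| + a + b / nu * (1 - expR (- nu * s)).
pose X (s : R) : R := (Z s - B s) * expR (lam * s).
have dX (s : R) : 0 < s -> is_derive s 1 X
    ((dZ s - b * expR (- nu * s)) * expR (lam * s) + (Z s - B s) * (lam * expR (lam * s))).
  move=> s0; have h1 := hd s s0; have h2 := is_derive_expR_lin lam s.
  have h3 := is_derive_expR_lin (- nu) s.
  rewrite /X /B; apply: is_derive_eq; rewrite /GRing.scale /=.
  by field; rewrite gt_eqF.
have cX : continuous X.
  apply: contM; last exact: continuous_expR_lin.
  apply: contD; first exact: cZ.
  apply/contN/contD; first exact: cont_cst.
  apply: contM; first exact: cont_cst.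
  apply: contD; first exact: cont_cst.
  by apply: contN; exact: continuous_expR_lin.
have Bbound (s : R) : 0 <= s -> a <= B s /\ B s <= `|Z 0| + a + b / nu.
  move=> s0; have e0 := expR_gt0 (- nu * s).
  have e1 : expR (- nu * s) <= 1 by rewrite -expR0 ler_expR mulNr oppr_le0 mulr_ge0 // ltW.
  have bn : 0 <= b / nu by rewrite divr_ge0 // ltW.
  have n0 := normr_ge0 (Z 0).
  have := mulr_ge0 bn (ltW e0).
  have : 0 <= b / nu * (1 - expR (- nu * s)) by rewrite mulr_ge0 // subr_ge0.
  by rewrite /B; lra.
have hX : X t <= X 0.
  apply: (nonincreasing_from0 cX dX) => // s s0.
  have := hle s s0; have := expR_gt0 (lam * s); have [h1 _] := Bbound s (ltW s0).
  set e := expR (lam * s) => e0 hs.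
  have -> : (dZ s - b * expR (- nu * s)) * e + (Z s - B s) * (lam * e) =
    (dZ s + lam * Z s - b * expR (- nu * s) - lam * B s) * e by ring.
  rewrite pmulr_lle0 //; have := ler_wpM2l lam0 h1; lra.
have [_ h2] := Bbound t t0; apply: le_trans h2.
have X0 : X 0 <= 0.
  rewrite /X /B !mulr0 expR0 subrr mulr0 addr0 mulr1; have := ler_norm (Z 0); lra.
have := le_trans hX X0; rewrite {1}/X pmulr_lle0 ?expR_gt0 //; lra.
Qed.

(** The factor [expR (c / mu)] is the exponential of the integral of [c * expR (- mu * t)] over all
    times. The gap [nu < mu] keeps the forcing integrable against [expR (nu * t)]. *)
Lemma gronwall E dE (l c d mu nu : R) :
  0 <= c -> 0 <= d -> 0 < nu -> nu < mu -> nu <= l -> continuous E ->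
  (forall t, 0 <= t -> 0 <= E t) ->
  (forall t, 0 < t -> is_derive t 1 E (dE t)) ->
  (forall t, 0 < t ->
    dE t <= - l * E t + c * expR (- mu * t) * E t + c * expR (- mu * t) * d) ->
  forall t, 0 <= t ->
    E t <= expR (c / mu) * (1 + c / (mu - nu)) * (E 0 + d) * expR (- nu * t).
Proof.
move=> c0 d0 nu0 numu nul cE E0 hd hle t t0.
have mu0 : 0 < mu by lra.
pose k := expR (c / mu).
have k1 : 1 <= k by rewrite -expR0 ler_expR divr_ge0 // ltW.
have mn0 : 0 < mu - nu by lra.
(* The factor of [E s] is an integrating factor [G] with logarithmic derivative
   [nu - c * expR (- mu * s)], which cancels the growth term. The second summand decreases at the
   rate [d * (k * c) * expR (- (mu - nu) * s)] and pays for the forcing, since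
   [G s <= expR (nu * s) * k]. *)
pose X (s : R) : R := E s * (expR (nu * s) * expR (c / mu * expR (- mu * s))) +
  d * (k * c / (mu - nu)) * expR (- (mu - nu) * s).
pose G (s : R) : R := expR (nu * s) * expR (c / mu * expR (- mu * s)).
have dG (s : R) : is_derive s 1 G ((nu - c * expR (- mu * s)) * G s).
  have h1 := is_derive_expR_lin nu s; have h2 := is_derive_expR_lin (- mu) s.
  have h3 : is_derive s 1 (fun s => c / mu * expR (- mu * s)) (- c * expR (- mu * s)).
    by apply: is_derive_eq; rewrite /GRing.scale /=; field; rewrite gt_eqF.
  have h4 := @is_derive1_comp R expR _ s _ _ (is_derive_expR _) h3.
  by apply: is_derive_eq; rewrite /GRing.scale /G /=; ring.
have dX (s : R) : 0 < s -> is_derive s 1 X (dE s * G s + E s * ((nu - c * expR (- mu * s)) * G s)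
   - d * (k * c) * expR (- (mu - nu) * s)).
  move=> s0; have h1 := hd s s0; have h2 := dG s; have h3 := is_derive_expR_lin (- (mu - nu)) s.
  rewrite /X -/G; apply: is_derive_eq; rewrite /GRing.scale /= -/(G s).
  set e := expR (- (mu - nu) * s); set r := expR (- mu * s); move: (G s) => g.
  by field; rewrite gt_eqF.
have cX : continuous X.
  apply: contD.
    by apply: contM => // s; exact: is_derive_continuous (dG s).
  by apply: contM; [exact: cont_cst|exact: continuous_expR_lin].
have G0 (s : R) : 0 < G s by rewrite mulr_gt0 ?expR_gt0.
have Gle (s : R) : 0 <= s -> expR (nu * s) <= G s /\ G s <= expR (nu * s) * k.
  move=> s0; have e0 := expR_gt0 (nu * s).
  have m1 : expR (- mu * s) <= 1 by rewrite -expR0 ler_expR mulNr oppr_le0 mulr_ge0 // ltW.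
  have cm : 0 <= c / mu by rewrite divr_ge0 // ltW.
  split; rewrite /G.
    by rewrite ler_peMr ?(ltW e0) // -expR0 ler_expR mulr_ge0 ?expR_ge0.
  by rewrite ler_pM2l // ler_expR ler_piMr.
have Xle : X t <= X 0.
  apply: (nonincreasing_from0 cX dX) => // s s0.
  have [_ Gs] := Gle s (ltW s0); have Gs0 := G0 s; have Es := E0 s (ltW s0).
  have m0 := expR_gt0 (- mu * s).
  have em : expR (- (mu - nu) * s) = expR (nu * s) * expR (- mu * s).
    by rewrite -expRD; congr expR; ring.
  rewrite em.
  have h1 : dE s + nu * E s - c * expR (- mu * s) * E s <= c * expR (- mu * s) * d.
    by have := hle s s0; have := ler_wpM2r Es nul; lra.
  have h2 := ler_wpM2r (ltW Gs0) h1.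
  have h3 : c * expR (- mu * s) * d * G s <= c * expR (- mu * s) * d * (expR (nu * s) * k).
    by apply: ler_wpM2l Gs; rewrite !mulr_ge0 // ltW.
  have -> : dE s * G s + E s * ((nu - c * expR (- mu * s)) * G s) =
    (dE s + nu * E s - c * expR (- mu * s) * E s) * G s by ring.
  have -> : d * (k * c) * (expR (nu * s) * expR (- mu * s)) =
     c * expR (- mu * s) * d * (expR (nu * s) * k) by ring.
  lra.
have [Gt _] := Gle t t0.
have q0 : 0 <= d * (k * c / (mu - nu)).
  by rewrite !mulr_ge0 ?invr_ge0 // ?(le_trans _ k1) // ltW.
have h1 : E t * expR (nu * t) <= X t.
  rewrite /X -/(G t); apply: le_trans (_ : E t * G t <= _); first by apply: ler_wpM2l; first exact: E0.
  by rewrite lerDl mulr_ge0 ?expR_ge0.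
have h2 : X 0 <= k * (1 + c / (mu - nu)) * (E 0 + d).
  rewrite /X !mulr0 expR0 !mulr1 mul1r -/k.
  have h3 : 0 <= k * (c / (mu - nu)) * E 0.
    by rewrite mulr_ge0 ?E0 // mulr_ge0 ?divr_ge0 ?(le_trans _ k1) // ltW.
  have h4 : 0 <= k * d by rewrite mulr_ge0 // (le_trans _ k1).
  by lra.
have := le_trans h1 (le_trans Xle h2).
rewrite -ler_pdivlMr ?expR_gt0 // => h; apply: le_trans h _.
by rewrite mulNr expRN.
Qed.

End Gronwall.

(** * Weak derivatives *)

Section WeakDerivatives.
Context {R : realType}.
Implicit Types (a b w phi : R -> R) (x y z e eta : R).
Notation mu := (@lebesgue_measure R).
Notation I := (@I01 R).
Local Hint Resolve measurable_I01 : core.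

Definition ramp z : R := Num.max z 0.

Lemma rampE z : (0 <= z /\ ramp z = z) \/ (z <= 0 /\ ramp z = 0).
Proof. by rewrite /ramp; case: (leP z 0) => h; [right|left; split => //; exact: ltW]. Qed.

(** The error of the linear approximation is at most [h * h], even across the kink. Squaring thus
    makes the ramp C^1, the regularity asked of test functions. *)
Lemma is_derive_ramp2 z : is_derive z 1 (fun y => ramp y ^+ 2) (2 * ramp z).
Proof.
apply/is_derive_epsP => e e0; exists e => // h he.
apply: (@le_trans _ _ (`|h| * `|h|)); last by rewrite ler_wpM2r // ltW.
rewrite -normrM; have -> : `|h * h| = h * h by rewrite ger0_norm // -expr2 sqr_ge0.
rewrite ler_norml; have [[h1 ->]|[h1 ->]] := rampE z;
  by have [[h2 ->]|[h2 ->]] := rampE (z + h); apply/andP; split; nra.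
Qed.

Lemma continuous_ramp : continuous ramp.
Proof.
move=> z; apply/cvgrPdist_le => e e0; exists e => // y /= hy.
apply: le_trans (ltW hy).
have [[h1 ->]|[h1 ->]] := rampE z; have [[h2 ->]|[h2 ->]] := rampE y => //.
- by rewrite subr0 !ger0_norm; lra.
- by rewrite sub0r normrN distrC !ger0_norm; lra.
- by rewrite subrr normr0.
Qed.

(* The quadratic B-spline and its primitive. *)
Definition tent e z := (ramp z - 2 * ramp (z - e) + ramp (z - 2 * e)) / e ^+ 2.

Definition smoothstep e z :=
  (ramp z ^+ 2 - 2 * ramp (z - e) ^+ 2 + ramp (z - 2 * e) ^+ 2) / (2 * e ^+ 2).

Lemma is_derive_smoothstep e y z : 0 < e ->
  is_derive z 1 (fun s => smoothstep e (s - y)) (tent e (z - y)).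
Proof.
move=> e0.
have d c : is_derive z 1 (fun s => ramp (s - c) ^+ 2) (2 * ramp (z - c)).
  have h1 : is_derive z 1 (fun s : R => s - c) 1.
    by apply: is_derive_eq; rewrite subr0.
  have := @is_derive1_comp R (fun s => ramp s ^+ 2) (fun s => s - c) z _ _
    (is_derive_ramp2 (z - c)) h1.
  by rewrite mulr1.
have d0 := d y; have d1 := d (y + e); have d2 := d (y + 2 * e).
have -> : (fun s => smoothstep e (s - y)) = (fun s => (ramp (s - y) ^+ 2
    - 2 * ramp (s - (y + e)) ^+ 2 + ramp (s - (y + 2 * e)) ^+ 2) / (2 * e ^+ 2)).
  by apply/funext => s; rewrite /smoothstep !opprD !addrA.
apply: is_derive_eq; rewrite /tent !opprD !addrA /GRing.scale /= mulr0 add0r.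
field; lra.
Qed.

Lemma continuous_tent e y : continuous (fun z => tent e (z - y)).
Proof.
have c d : continuous (fun z => ramp (z - y - d)).
  apply: (cont_comp continuous_ramp); apply: contD; last exact: cont_cst.
  by apply: contD; [move=> ?; exact: cvg_id|exact: cont_cst].
apply: contM; last exact: cont_cst.
apply: contD; last exact: c.
apply: contD.
  by have := c 0; under eq_fun do rewrite subr0.
by apply/contN/contM; [exact: cont_cst|exact: c].
Qed.

Lemma tent_ge0 e z : 0 < e -> 0 <= tent e z.
Proof.
move=> e0; rewrite /tent divr_ge0 ?sqr_ge0 //.
have [[h1 ->]|[h1 ->]] := rampE z; have [[h2 ->]|[h2 ->]] := rampE (z - e);
  by have [[h3 ->]|[h3 ->]] := rampE (z - 2 * e); lra.
Qed.

Lemma tent_out e z : 0 < e -> z <= 0 \/ 2 * e <= z -> tent e z = 0.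
Proof.
move=> e0 hz; apply/eqP; rewrite /tent mulf_eq0; apply/orP; left; apply/eqP.
have [[h1 ->]|[h1 ->]] := rampE z; have [[h2 ->]|[h2 ->]] := rampE (z - e);
  have [[h3 ->]|[h3 ->]] := rampE (z - 2 * e); case: hz => ?; lra.
Qed.

Lemma smoothstep01 e z : 0 < e -> 0 <= smoothstep e z <= 1.
Proof.
move=> e0; rewrite /smoothstep; have e2 : 0 < 2 * e ^+ 2 by rewrite mulr_gt0 ?exprn_gt0.
rewrite ler_pdivlMr // ler_pdivrMr // mul0r mul1r.
have [[h1 ->]|[h1 ->]] := rampE z; have [[h2 ->]|[h2 ->]] := rampE (z - e);
  have [[h3 ->]|[h3 ->]] := rampE (z - 2 * e); apply/andP; split; nra.
Qed.

Lemma smoothstep0 e z : 0 < e -> z <= 0 -> smoothstep e z = 0.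
Proof.
move=> e0 hz; apply/eqP; rewrite /smoothstep mulf_eq0; apply/orP; left; apply/eqP.
have [[h1 ->]|[h1 ->]] := rampE z; have [[h2 ->]|[h2 ->]] := rampE (z - e);
  have [[h3 ->]|[h3 ->]] := rampE (z - 2 * e); nra.
Qed.

Lemma smoothstep1 e z : 0 < e -> 2 * e <= z -> smoothstep e z = 1.
Proof.
move=> e0 hz; have rE y : 0 <= y -> ramp y = y by rewrite /ramp => /max_l.
by rewrite /smoothstep !rE; [field|..]; lra.
Qed.

Lemma Rintegral_tent e y : 0 < e -> 0 < y -> y + 2 * e < 1 ->
  \int[mu]_(z in I) tent e (z - y) = 1.
Proof.
move=> e0 y0 y1.
have cs : continuous (fun z => smoothstep e (z - y)).
  by move=> z; exact: is_derive_continuous (is_derive_smoothstep y z e0).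
have -> := FTC_I01 cs (@continuous_tent e y) (fun x _ => is_derive_smoothstep y x e0).
by rewrite smoothstep1 ?smoothstep0 ?subr0 //; lra.
Qed.

(** The hat has unit mass and lives on [[y, y + 2 * e]], so the integral is a weighted average of
    [a] near [y]. *)
Lemma tent_average a e y eta : mu.-integrable I (EFin \o a) ->
  0 < e -> 0 < y -> y + 2 * e < 1 ->
  (forall z, y <= z <= y + 2 * e -> `|a z - a y| <= eta) ->
  `|\int[mu]_(z in I) (a z * tent e (z - y)) - a y| <= eta.
Proof.
move=> ia e0 y0 y1 ha; have ct := continuous_tent (e := e) (y := y).
have it := continuous_integrable ct.
have iat := integrable_mulcont ia ct.
have icst c : mu.-integrable I (EFin \o (fun z => c * tent e (z - y))).
  by apply: continuous_integrable; apply: contM => //; exact: cont_cst.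
have -> : \int[mu]_(z in I) (a z * tent e (z - y)) - a y =
    \int[mu]_(z in I) (a z * tent e (z - y) - a y * tent e (z - y)).
  by rewrite RintegralB // RintegralZl // Rintegral_tent // mulr1.
have i1 : mu.-integrable I (EFin \o (fun z => a z * tent e (z - y) - a y * tent e (z - y))).
  exact: (integrableB measurable_I01 iat (icst (a y))).
apply: le_trans (le_normr_Rintegral _ i1) _ => //.
have -> : eta = \int[mu]_(z in I) (eta * tent e (z - y)).
  by rewrite RintegralZl // Rintegral_tent // mulr1.
apply: le_Rintegral => //; first exact: integrable_norm i1.
move=> z _; rewrite -mulrBl normrM (ger0_norm (tent_ge0 _ e0)).
have [h|h] := boolP (y <= z <= y + 2 * e).
  by apply: ler_wpM2r; [exact: tent_ge0|exact: ha].
rewrite tent_out ?mulr0 //; move: h; rewrite negb_and -!ltNge => /orP[] ?; [left|right]; lra.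
Qed.

Lemma mem_itvcc x y z : (z \in (`[x, y]%classic : set R)) = (x <= z <= y).
Proof. by apply/idP/idP; rewrite inE /= in_itv. Qed.

Lemma within01_eps a z e : {within `[0, 1]%classic, continuous a} ->
  0 <= z <= 1 -> 0 < e -> exists2 r, 0 < r &
    forall s, 0 <= s <= 1 -> `|s - z| < r -> `|a s - a z| <= e.
Proof.
move=> /subspace_continuousP ca z01 e0.
have zin : (`[0, 1]%classic : set R) z by rewrite /= in_itv.
have /cvgrPdist_le /(_ e e0) [r /= r0 hr] := ca z zin.
exists r => // s s01 hs; rewrite distrC; apply: hr => /=; last by rewrite in_itv.
by rewrite distrC.
Qed.

(** Tested with a plateau that rises just after [y] and falls just after [x], the weak identity
    compares averages of [a] near the two points. The bound [M] is asked for all functions with the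
    size and support of a plateau, so that it may come from the L^1 norm of [b] or from its
    smallness on [[y, x']]. *)
Lemma weak_increment a b x y x' M : weak_derivative a b ->
  {within `[0, 1]%classic, continuous a} -> 0 < y < x -> x < x' < 1 ->
  (forall phi, continuous phi -> (forall z, `|phi z| <= 1) ->
     (forall z, ~~ (y <= z <= x') -> phi z = 0) ->
     `|\int[mu]_(z in I) (b z * phi z)| <= M) ->
  `|a x - a y| <= M.
Proof.
move=> wd ca /andP[y0 yx] /andP[xx' x'1] hM.
have ia := within_integrable ca.
apply/ler_addgt0Pr => eta eta0; have eta2 : 0 < eta / 2 by lra.
have x01 : 0 <= x <= 1 by lra.
have y01 : 0 <= y <= 1 by lra.
have [r1 r10 h1] := within01_eps ca x01 eta2.
have [r2 r20 h2] := within01_eps ca y01 eta2.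
(* With a third of the minimum, each hat of width [2 * e] fits into its gap and stays within the
   radius of continuity. *)
pose e := Num.min (Num.min r1 r2) (Num.min (x' - x) (x - y)) / 3.
have [e0 [er1 [er2 [ex ey]]]] :
    0 < e /\ (3 * e <= r1 /\ (3 * e <= r2 /\ (3 * e <= x' - x /\ 3 * e <= x - y))).
  have -> : 3 * e = Num.min (Num.min r1 r2) (Num.min (x' - x) (x - y)).
    by rewrite /e; field.
  rewrite !ge_min !lexx !orbT /=; split => //.
  by rewrite /e divr_gt0 // !lt_min r10 r20 !subr_gt0 xx' yx.
pose phi z := smoothstep e (z - y) - smoothstep e (z - x).
have dphi z : is_derive z 1 phi (tent e (z - y) - tent e (z - x)).
  have d1 := is_derive_smoothstep y z e0; have d2 := is_derive_smoothstep x z e0.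
  exact: is_deriveB.
have ephi : derive1 phi = fun z => tent e (z - y) - tent e (z - x).
  by apply/funext => z; exact: is_derive_derive1.
have cphi : continuous phi by move=> z; exact: is_derive_continuous (dphi z).
have ct c := continuous_tent (e := e) (y := c).
have sphi z : ~~ (y <= z <= x') -> phi z = 0.
  rewrite negb_and -!ltNge /phi => /orP[] hz.
    by rewrite !smoothstep0 ?subrr //; lra.
  by rewrite !smoothstep1 ?subrr //; lra.
have tphi : test_function phi.
  split; first by move=> z; have [] := dphi z.
  - by rewrite ephi; apply: contD => //; apply: contN.
  - exists y, x'; split => //; [lra|move=> z hz; apply: sphi; apply: contra hz].
    by rewrite inE /= in_itv.
have iat c : mu.-integrable I (EFin \o (fun z => a z * tent e (z - c))).
  exact: integrable_mulcont ia (ct c).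
have := wd phi tphi; rewrite ephi.
have -> : \int[mu]_(z in I) (a z * (tent e (z - y) - tent e (z - x))) =
    \int[mu]_(z in I) (a z * tent e (z - y)) - \int[mu]_(z in I) (a z * tent e (z - x)).
  by rewrite -RintegralB //; apply: eq_Rintegral => z _; rewrite mulrBr.
move=> E.
have hb := hM phi cphi _ sphi.
have {}hb : `|\int[mu]_(z in I) (b z * phi z)| <= M.
  apply: hb => z; have := smoothstep01 (z - y) e0; have := smoothstep01 (z - x) e0.
  by rewrite /phi ler_norml; lra.
have A1 : `|\int[mu]_(z in I) (a z * tent e (z - y)) - a y| <= eta / 2.
  apply: tent_average => //; [lra|move=> z hz; apply: h2; first by lra].
  by rewrite ger0_norm; lra.
have A2 : `|\int[mu]_(z in I) (a z * tent e (z - x)) - a x| <= eta / 2.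
  apply: tent_average => //; [lra|lra|move=> z hz; apply: h1; first by lra].
  by rewrite ger0_norm; lra.
move: E A1 A2 hb; rewrite !ler_norml; lra.
Qed.

Lemma test_functionP phi : test_function phi ->
  [/\ continuous phi, continuous (derive1 phi),
      forall x, is_derive x 1 phi (derive1 phi x), phi 0 = 0 & phi 1 = 0].
Proof.
case=> dphi cphi [c [d [c0 cd d1 sphi]]]; split => //.
- by move=> x; apply/differentiable_continuous/derivable1_diffP.
- by move=> x; exact: derivable_is_derive.
- by apply: sphi; apply/negP; rewrite inE /= in_itv /=; lra.
- by apply: sphi; apply/negP; rewrite inE /= in_itv /=; lra.
Qed.

Lemma classical_weak_derivative a b : continuous a -> continuous b ->
  (forall x, 0 < x < 1 -> is_derive x 1 a (b x)) -> weak_derivative a b.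
Proof.
move=> ca cb da phi /test_functionP [cphi cdphi dphi p0 p1].
have i1 : mu.-integrable I (EFin \o (fun x => a x * derive1 phi x)).
  exact/continuous_integrable/contM.
have i2 : mu.-integrable I (EFin \o (fun x => b x * phi x)).
  exact/continuous_integrable/contM.
apply/eqP; rewrite -subr_eq0 opprK -RintegralD //.
have dap x : 0 < x < 1 ->
    is_derive x 1 (fun x => a x * phi x) (a x * derive1 phi x + b x * phi x).
  move=> x01; have d1 := da x x01; have d2 := dphi x.
  by apply: is_derive_eq; rewrite /GRing.scale /= (mulrC (phi x)).
have -> := FTC_I01 (contM ca cphi) _ dap; last by apply: contD; exact: contM.
by rewrite p0 p1 !mulr0 subrr.
Qed.

Lemma weak_derivativeB a b a' b' :
  mu.-integrable I (EFin \o a) -> mu.-integrable I (EFin \o a') ->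
  mu.-integrable I (EFin \o b) -> mu.-integrable I (EFin \o b') ->
  weak_derivative a b -> weak_derivative a' b' ->
  weak_derivative (fun x => a x - a' x) (fun x => b x - b' x).
Proof.
move=> ia ia' ib ib' w w' phi tphi; have [cphi cdphi _ _ _] := test_functionP tphi.
under eq_Rintegral do rewrite mulrBl.
rewrite RintegralB ?w ?w' //; try exact: integrable_mulcont.
under [in RHS]eq_Rintegral do rewrite mulrBl.
by rewrite RintegralB //; [ring|exact: integrable_mulcont..].
Qed.

End WeakDerivatives.

(** * Sobolev embedding and recovery of classical derivatives *)

Section Sobolev.
Context {R : realType}.
Implicit Types (a b w phi : R -> R) (x y z e : R) (i k : nat).
Notation mu := (@lebesgue_measure R).
Notation I := (@I01 R).
Local Hint Resolve measurable_I01 : core.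

Lemma weak_derivative_oscillation a b x y : weak_derivative a b ->
  mu.-integrable I (EFin \o b) ->
  {within `[0, 1]%classic, continuous a} -> 0 < x < 1 -> 0 < y < 1 ->
  `|a x - a y| <= \int[mu]_(z in I) `|b z|.
Proof.
move=> wd ib ca; wlog yx : x y / y < x.
  move=> H x01 y01; have [xy|yx|->] := ltgtP x y; last 1 first.
  - by rewrite subrr normr0 Rintegral_ge0.
  - by rewrite distrC; exact: H.
  - exact: H.
move=> x01 y01; apply: (weak_increment (x' := (x + 1) / 2) wd ca); try lra.
move=> phi cphi phi1 _; have ibp := integrable_mulcont ib cphi.
apply: le_trans (le_normr_Rintegral measurable_I01 ibp) _.
apply: le_Rintegral => //; [exact: integrable_norm|exact: integrable_norm|].
by move=> z _; rewrite normrM ler_piMr.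
Qed.

(** Average the oscillation bound over the second point. This is how pointwise control of u - uh and
    v - vh is recovered from their means. *)
Lemma mean_oscillation a b x : continuous a -> continuous b ->
  (forall x, 0 < x < 1 -> is_derive x 1 a (b x)) -> 0 < x < 1 ->
  `|a x| <= `|\int[mu]_(y in I) a y| + \int[mu]_(z in I) `|b z|.
Proof.
move=> ca cb dab x01.
have wd := classical_weak_derivative ca cb dab.
have ib := continuous_integrable cb; have ia := continuous_integrable ca.
have icst c : mu.-integrable I (EFin \o cst c) by exact/continuous_integrable/cont_cst.
set M := \int[mu]_(z in I) `|b z|.
have id : mu.-integrable I (EFin \o (fun y => a x - a y)).
  exact: (integrableB measurable_I01 (icst (a x)) ia).
have h : `|\int[mu]_(y in I) (a x - a y)| <= M.
  apply: le_trans (le_normr_Rintegral measurable_I01 id) _.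
  rewrite -[leRHS](@Rintegral_I01_cst R); apply: le_Rintegral => //.
    exact: integrable_norm id.
    exact: icst.
  move=> y /I01P y01; apply: weak_derivative_oscillation => //.
  exact: continuous_subspaceT.
have e : \int[mu]_(y in I) (a x - a y) = a x - \int[mu]_(y in I) a y.
  have := RintegralB measurable_I01 (icst (a x)) ia.
  by rewrite Rintegral_I01_cst.
by rewrite e in h; rewrite -lerBlDl; apply: le_trans (lerB_dist _ _) h.
Qed.

(** The oscillation of [a] is at most [L2norm b], so [|a|] stays above [|a x| - L2norm b] on the
    whole interval, and hence so does its norm. *)
Lemma Sobolev_open a b x : weak_derivative a b -> L2 a -> L2 b ->
  {within `[0, 1]%classic, continuous a} -> 0 < x < 1 ->
  `|a x| <= L2norm a + L2norm b.
Proof.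
move=> wd la lb ca x01; rewrite -lerBlDr; apply: L2norm_ge => // y y01.
have := weak_derivative_oscillation wd (L2_integrable lb) ca x01 y01.
have := ler_normD (a x - a y) (a y); have := L1_le_L2norm lb; rewrite subrK; lra.
Qed.

Lemma closure01 a c : {within `[0, 1]%classic, continuous a} ->
  (forall x, 0 < x < 1 -> `|a x| <= c) -> forall x, 0 <= x <= 1 -> `|a x| <= c.
Proof.
move=> ca hc x x01; apply/ler_addgt0Pr => e e0.
have [r r0 hr] := within01_eps ca x01 e0.
pose d := Num.min r 1 / 4.
have [d0 [dr d1]] : 0 < d /\ (4 * d <= r /\ 4 * d <= 1).
  have -> : 4 * d = Num.min r 1 by rewrite /d; field.
  by rewrite !ge_min !lexx orbT; split => //; rewrite /d divr_gt0 // lt_min r0 ltr01.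
suff [s [s01 sx]] : exists s, 0 < s < 1 /\ `|s - x| < r.
  have s01' : 0 <= s <= 1 by lra.
  have := hr s s01' sx; have := hc s s01.
  have := ler_normB (a s) (a s - a x); rewrite opprB addrC subrK; lra.
have [h|h] := leP x (1 / 2).
- by exists (x + d); split; [lra|rewrite addrC addKr gtr0_norm //; lra].
- by exists (x - d); split; [lra|rewrite addrC addKr normrN gtr0_norm //; lra].
Qed.

Lemma Sobolev a b x : weak_derivative a b -> L2 a -> L2 b ->
  {within `[0, 1]%classic, continuous a} -> 0 <= x <= 1 ->
  `|a x| <= L2norm a + L2norm b.
Proof.
move=> wd la lb ca; apply: closure01 => // y; exact: Sobolev_open.
Qed.

(** Once the linear function [b z * s] is subtracted, the weak derivative is at most [e] near [z],
    so increments of the remainder are at most [e] times the length. *)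
Lemma weak_derivative_classical a b z : weak_derivative a b ->
  {within `[0, 1]%classic, continuous a} -> {within `[0, 1]%classic, continuous b} ->
  0 < z < 1 -> is_derive z 1 a (b z).
Proof.
move=> wd ca cb z01; apply/is_derive_epsP => e e0.
have z01' : 0 <= z <= 1 by lra.
have [r r0 hr] := within01_eps cb z01' e0.
pose alpha s := a s - b z * s; pose beta s := b s - b z.
have cid : continuous (fun s : R => b z * s).
  by apply: contM; [exact: cont_cst|move=> s; exact: cvg_id].
have cid' : continuous (fun _ : R => b z) by exact: cont_cst.
have wd' : weak_derivative alpha beta.
  apply: weak_derivativeB => //; try exact: within_integrable;
    try exact: continuous_integrable.
  apply: classical_weak_derivative => // s _.
  by apply: is_derive_eq; rewrite /GRing.scale /= mulr1.
have calpha : {within `[0, 1]%classic, continuous alpha}.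
  move=> s; apply: continuousB; first exact: ca.
  by apply: continuous_subspaceT.
have ibeta : mu.-integrable I (EFin \o beta).
  exact: (integrableB measurable_I01 (within_integrable cb) (continuous_integrable cid')).
have key x y : y < x -> 0 < y -> x < 1 -> `|x - z| < r -> `|y - z| < r ->
    `|alpha x - alpha y| <= e * (x - y).
  move=> yx y0 x1 xz yz.
  (* The plateau overshoots [x] by [d]; the bound on the longer interval gives the claim as [d]
     tends to 0. *)
  suff H d : 0 < d -> x + d < 1 -> `|x + d - z| < r -> `|alpha x - alpha y| <= e * (x + d - y).
    apply/ler_addgt0Pr => eta eta0.
    move: xz; rewrite ltr_norml => /andP[xz1 xz2].
    pose d := Num.min (eta / e) (Num.min (1 - x) (z + r - x)) / 2.
    have [d0 [d1 [d2 d3]]] : 0 < d /\ (2 * d <= eta / e /\ (2 * d <= 1 - x /\ 2 * d <= z + r - x)).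
      have -> : 2 * d = Num.min (eta / e) (Num.min (1 - x) (z + r - x)) by rewrite /d; field.
      rewrite !ge_min !lexx !orbT; split => //; rewrite /d divr_gt0 // !lt_min.
      by rewrite divr_gt0 //=; lra.
    apply: le_trans (H d _ _ _) _ => //; first lra.
      by rewrite ltr_norml; lra.
    have : d * e <= eta by rewrite -ler_pdivlMr //; lra.
    by lra.
  move=> d0 xd1 xdz; apply: (weak_increment (x' := x + d) wd' calpha); try lra.
  move=> phi cphi phi1 phi0.
  have ibp := integrable_mulcont ibeta cphi.
  apply: le_trans (le_normr_Rintegral measurable_I01 ibp) _.
  have -> : e * (x + d - y) = \int[mu]_(s in I) ((cst e) \_ `[y, x + d]%classic) s.
    rewrite -Rintegral_mkcondr.
    have -> : I `&` `[y, x + d]%classic = `[y, x + d]%classic.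
      apply/seteqP; split => [s [] //|s hs]; split => //.
      by apply/I01P; move: hs; rewrite /= in_itv /=; lra.
    have mE := lebesgue_measure_itv (Interval (BLeft y) (BRight (x + d))).
    rewrite /= lte_fin (_ : y < x + d) in mE; last by lra.
    rewrite Rintegral_cst //; congr (_ * _); symmetry; exact: (congr1 fine mE).
  apply: le_Rintegral => //; first exact: integrable_norm.
    have icst : mu.-integrable I (EFin \o cst e) by exact/continuous_integrable/cont_cst.
    apply: (le_integrable measurable_I01 _ _ icst).
      apply/measurable_EFinP/measurable_restrict => //; exact: measurable_itv.
    move=> s _ /=; rewrite lee_fin /patch; case: ifPn => // _.
    by rewrite normr0.
  move=> s Is; rewrite /patch mem_itvcc; case: ifPn => [h|h]; last first.
    by rewrite phi0 ?mulr0 ?normr0.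
  rewrite normrM; apply: (@le_trans _ _ `|beta s|); first by rewrite ler_piMr.
  apply: hr; first by move/I01P : Is; lra.
  by move: xdz yz; rewrite !ltr_norml; lra.
exists (Num.min r (Num.min z (1 - z))) => [|h].
  by rewrite !lt_min r0; lra.
rewrite !lt_min => /andP[hr1 /andP[hr2 hr3]].
have -> : a (z + h) - a z - b z * h = alpha (z + h) - alpha z by rewrite /alpha; ring.
have z0 : `|z - z| < r by rewrite subrr normr0.
have zh : `|z + h - z| < r by rewrite addrC addKr.
have [h0|h0|->] := ltgtP h 0; last by rewrite addr0 subrr !normr0 mulr0.
- have -> : e * `|h| = e * (z - (z + h)) by rewrite (ltr0_norm h0); ring.
  by rewrite (ltr0_norm h0) in hr2 hr3; rewrite distrC; apply: key => //; lra.
- have -> : e * `|h| = e * (z + h - z) by rewrite (gtr0_norm h0); ring.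
  by rewrite (gtr0_norm h0) in hr2 hr3; apply: key => //; lra.
Qed.

End Sobolev.

(** * Jets and classical solutions *)

Section Jets.
Context {R : realType}.
Implicit Types (u v w : jet R) (x y z e c t : R) (i k : nat).
Notation mu := (@lebesgue_measure R).
Notation I := (@I01 R).
Local Hint Resolve measurable_I01 : core.

Lemma Hnorm_ge0 k w : 0 <= Hnorm k w.
Proof. exact: sqrtr_ge0. Qed.

Lemma L2norm_le_Hnorm k w i : (i <= k)%N -> L2norm (w i) <= Hnorm k w.
Proof.
move=> ik; rewrite /Hnorm -[leLHS]ger0_norm ?L2norm_ge0 // -sqrtr_sqr.
apply: ler_wsqrtr; rewrite (bigD1 (Ordinal (ik : (i < k.+1)%N))) //= lerDl.
by apply: sumr_ge0 => j _; exact: sqr_ge0.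
Qed.

Lemma Hnorm0E w : Hnorm 0 w = L2norm (w 0%N).
Proof. by rewrite /Hnorm big_ord1 sqrtr_sqr ger0_norm // L2norm_ge0. Qed.

Lemma Hnorm_le_Hnorm2l k u v : Hnorm k u <= Hnorm2 k u v.
Proof.
rewrite /Hnorm2 -[leLHS]ger0_norm ?Hnorm_ge0 // -sqrtr_sqr.
by apply: ler_wsqrtr; rewrite lerDl sqr_ge0.
Qed.

Lemma Hnorm_le_Hnorm2r k u v : Hnorm k v <= Hnorm2 k u v.
Proof.
rewrite /Hnorm2 -[leLHS]ger0_norm ?Hnorm_ge0 // -sqrtr_sqr.
by apply: ler_wsqrtr; rewrite lerDr sqr_ge0.
Qed.

Lemma inH_sup k w i x : inH k w -> (i < k)%N -> 0 <= x <= 1 ->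
  `|w i x| <= L2norm (w i) + L2norm (w i.+1).
Proof.
move=> [hL hW hC] ik x01.
apply: Sobolev (hW i ik) _ _ (hC i ik) x01; apply: hL => //; exact: ltnW.
Qed.

Lemma inH_sup_Hnorm k w i x : inH k w -> (i < k)%N -> 0 <= x <= 1 ->
  `|w i x| <= 2 * Hnorm k w.
Proof.
move=> hw ik x01; have := inH_sup hw ik x01.
have := L2norm_le_Hnorm w (ltnW ik); have := L2norm_le_Hnorm w ik; lra.
Qed.

Lemma inH_dx k w : inH k.+1 w -> inH k (dx w).
Proof. by move=> [hL hW hC]; split=> i ik; [exact: hL|exact: hW|exact: hC]. Qed.

Lemma inH_classical k w i x : inH k w -> (i.+1 < k)%N -> 0 < x < 1 ->
  is_derive x 1 (w i) (w i.+1 x).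
Proof.
move=> [hL hW hC] ik x01.
apply: weak_derivative_classical => //; [apply: hW|apply: hC|apply: hC] => //; exact: ltnW.
Qed.

Lemma inHB k u v : inH k u -> inH k v -> inH k (u - v).
Proof.
move=> [uL uW uC] [vL vW vC]; split => i ik.
- by apply: L2B; [exact: uL|exact: vL].
- apply: weak_derivativeB; try exact: uW; try exact: vW;
    by apply: L2_integrable; (apply: uL || apply: vL) => //; exact: ltnW.
- by move=> x; apply: continuousB; [exact: uC|exact: vC].
Qed.

Lemma inH_jconst k c : inH k (jconst c).
Proof.
have cc i : continuous (jconst c i : R -> R) by case: i => [|i]; exact: cont_cst.
split=> i ik.
- exact/within_L2/continuous_subspaceT.
- apply: classical_weak_derivative => // x _; case: i {ik} => [|i] /=; exact: is_derive_cst.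
- exact: continuous_subspaceT.
Qed.

Definition clamp x : R := Num.max 0 (Num.min x 1).

Lemma clamp_itv x : 0 <= clamp x <= 1.
Proof. by rewrite /clamp le_max lexx ge_max ler01 ge_min lexx orbT. Qed.

Lemma clamp_id x : 0 <= x <= 1 -> clamp x = x.
Proof. by move=> /andP[x0 x1]; rewrite /clamp min_l // max_r. Qed.

Lemma clampE x : (x <= 0 /\ clamp x = 0) \/ (0 <= x <= 1 /\ clamp x = x) \/
  (1 <= x /\ clamp x = 1).
Proof.
rewrite /clamp; case: (leP x 1) => h1.
  by case: (leP 0 x) => h2; [right; left; split; lra|left; split; lra].
by right; right; split; [lra|rewrite max_r].
Qed.

Lemma clamp_lip x y : `|clamp x - clamp y| <= `|x - y|.
Proof.
have h1 := ler_norm (x - y); have h2 := ler_norm (y - x); rewrite distrC in h2.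
by have [[h ->]|[[h ->]|[h ->]]] := clampE x;
  have [[h' ->]|[[h' ->]|[h' ->]]] := clampE y; rewrite ler_norml; lra.
Qed.

Lemma max0_lip t s : `|Num.max 0 t - Num.max 0 s| <= `|t - s|.
Proof.
have h1 := ler_norm (t - s); have h2 := ler_norm (s - t); rewrite distrC in h2.
by case: (leP 0 t) => h; case: (leP 0 s) => h'; rewrite ler_norml; lra.
Qed.

(* Clamping both variables turns statements on [0,oo) x [0,1] into statements
   about functions continuous on the whole plane. *)
Definition ext (u : R -> jet R) i t x := u (Num.max 0 t) i (clamp x).

Lemma extE (u : R -> jet R) i t x : 0 <= t -> 0 <= x <= 1 -> ext u i t x = u t i x.
Proof. by move=> t0 x01; rewrite /ext max_r // clamp_id. Qed.

(** By the embedding, continuity in time with values in H^3 is uniform in x for orders below 3;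
    continuity in x at one fixed time then gives joint continuity. *)
Lemma ext_continuous (u : R -> jet R) i : C0H3 u -> (i < 3)%N ->
  continuous (fun z : R * R => ext u i z.1 z.2).
Proof.
move=> [uH uC] i3 [t x]; apply/cvgrPdist_le => e e0.
have e4 : 0 < e / 4 by lra.
have T0 : 0 <= Num.max 0 t by rewrite le_max lexx.
have := uC (Num.max 0 t) T0.
move=> /cvgrPdist_le /(_ _ e4) [r /= r0 hr].
have [_ _ /(_ i i3) hC] := uH _ T0.
have [q q0 hq] := within01_eps hC (clamp_itv x) (ltac:(lra) : 0 < e / 2).
exists (ball t r, ball x q).
  by split; apply: nbhsx_ballx.
move=> [s y] /= [hs hy].
have S0 : 0 <= Num.max 0 s by rewrite le_max lexx.
rewrite /ext /=.
have h1 : `|u (Num.max 0 s) i (clamp y) - u (Num.max 0 t) i (clamp y)| <= 2 * (e / 4).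
  have hH := inHB (uH _ S0) (uH _ T0).
  apply: le_trans (inH_sup_Hnorm hH i3 (clamp_itv y)) _.
  rewrite ler_pM2l //; have := hr (Num.max 0 s) _ S0.
  rewrite sub0r normrN; move=> h; apply: le_trans (ler_norm _) (h _).
  exact: le_lt_trans (max0_lip _ _) hs.
have h2 : `|u (Num.max 0 t) i (clamp y) - u (Num.max 0 t) i (clamp x)| <= e / 2.
  apply: hq; first exact: clamp_itv.
  by apply: le_lt_trans (clamp_lip _ _) _; rewrite distrC.
have := ler_distD (u (Num.max 0 t) i (clamp y)) (u (Num.max 0 s) i (clamp y)) (u (Num.max 0 t) i (clamp x)).
by rewrite [in X in _ -> X]distrC; lra.
Qed.

Lemma ext_dx (u : R -> jet R) i t x : C0H3 u -> (i < 2)%N -> 0 < x < 1 ->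
  is_derive x 1 (ext u i t) (ext u i.+1 t x).
Proof.
move=> [uH _] i2 x01; have T0 : 0 <= Num.max 0 t by rewrite le_max lexx.
have x01' : 0 <= x <= 1 by lra.
have d := inH_classical (uH _ T0) (i2 : (i.+1 < 3)%N) x01.
rewrite /ext (clamp_id x01').
apply: is_derive_near (_ : 0 < Num.min x (1 - x)) _ d; first by rewrite lt_min; lra.
move=> y; rewrite lt_min !ltr_norml => h; rewrite clamp_id //; lra.
Qed.

End Jets.

(** * Smooth nonlinearities and the flux derivative [hfun g] *)

Section Smooth.
Context {R : realType}.
Implicit Types (f g : R -> R) (s x : R).

Lemma smooth_derive1 f : smooth f -> smooth (derive1 f).
Proof. by move=> sf n x; rewrite -derive1Sn; exact: sf. Qed.

Lemma smooth_is_derive f x : smooth f -> is_derive x 1 f (derive1 f x).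
Proof. by move=> sf; apply: derivable_is_derive; exact: (sf 0%N). Qed.

Lemma smooth_continuous f : smooth f -> continuous f.
Proof. by move=> sf x; exact: is_derive_continuous (smooth_is_derive x sf). Qed.

Lemma cont_id : continuous (fun x : R => x).
Proof. by move=> x; exact: cvg_id. Qed.

Lemma hfun_continuous g : smooth g -> continuous (hfun g).
Proof.
move=> sg; apply: contD; last exact: smooth_continuous.
by apply: contM; [exact/smooth_continuous/smooth_derive1|exact: cont_id].
Qed.

Lemma is_derive_flux g x : smooth g -> is_derive x 1 (fun s => g s * s) (hfun g x).
Proof.
move=> sg; have d := smooth_is_derive x sg.
by apply: is_derive_eq; rewrite /GRing.scale /hfun /=; ring.
Qed.

Lemma hfun_C1 g : smooth g -> exists2 dh : R -> R, continuous dh &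
  forall x, is_derive x 1 (hfun g) (dh x).
Proof.
move=> sg; have sg1 := smooth_derive1 sg; have sg2 := smooth_derive1 sg1.
exists (fun x => derive1 (derive1 g) x * x + 2 * derive1 g x).
  apply: contD; apply: contM; try exact: smooth_continuous; first exact: cont_id.
  exact: cont_cst.
move=> x; have d1 := smooth_is_derive x sg; have d2 := smooth_is_derive x sg1.
by apply: is_derive_eq; rewrite /GRing.scale /=; ring.
Qed.

End Smooth.

(** * From solutions in C^0(H^3) to pointwise equations *)

Section ClassicalSolutions.
Context {R : realType}.
Implicit Types (f g F dF : R -> R) (s t x y e kap k : R) (i : nat).

(* Classical form of both systems, with source term [kap (F u - v)]: [kap = 1/tau]
   gives (P), and [kap = 0] gives (L) and (H). *)
Record classical_solution F dF g kap k (U V : nat -> R -> R -> R) : Prop := {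
  cs_contU : forall i, (i < 3)%N -> continuous (fun z : R * R => U i z.1 z.2);
  cs_contV : forall i, (i < 3)%N -> continuous (fun z : R * R => V i z.1 z.2);
  cs_Ux : forall i t x, (i < 2)%N -> 0 < x < 1 -> is_derive x 1 (U i t) (U i.+1 t x);
  cs_Vx : forall i t x, (i < 2)%N -> 0 < x < 1 -> is_derive x 1 (V i t) (V i.+1 t x);
  cs_U0t : forall t x, 0 < t -> 0 < x < 1 -> is_derive t 1 (U 0%N ^~ x) (- V 1%N t x);
  cs_V0t : forall t x, 0 < t -> 0 < x < 1 -> is_derive t 1 (V 0%N ^~ x)
    (kap * (F (U 0%N t x) - V 0%N t x) - g (U 1%N t x) * U 1%N t x);
  cs_U1t : forall t x, 0 < t -> 0 < x < 1 -> is_derive t 1 (U 1%N ^~ x) (- V 2%N t x);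
  cs_V1t : forall t x, 0 < t -> 0 < x < 1 -> is_derive t 1 (V 1%N ^~ x)
    (kap * (dF (U 0%N t x) * U 1%N t x - V 1%N t x) - hfun g (U 1%N t x) * U 2%N t x);
  cs_left : forall t, 0 < t -> U 1%N t 0 = 0;
  cs_right : forall t, 0 < t -> U 1%N t 1 = k * V 1%N t 1 }.

(** Time increments at interior points are controlled by [B], and letting x tend to 1 carries the
    estimate to the boundary. This extends u_t = - v_x to x = 1, where the boundary condition
    involves u_t. *)
Lemma boundary_time_derivative (A B : R -> R -> R) t d : 0 < t ->
  continuous (fun z : R * R => A z.1 z.2) -> continuous (fun z : R * R => B z.1 z.2) ->
  (forall s x, 0 < s -> 0 < x < 1 -> is_derive s 1 (A ^~ x) (B s x)) ->
  is_derive t 1 (A ^~ 1) d -> d = B t 1.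
Proof.
move=> t0 cA cB dA dd; apply/eqP; rewrite -subr_eq0 -normr_le0.
apply/ler_addgt0Pr => e e0; rewrite add0r.
have [r r0 hr] := continuous_eps2 (cB (t, 1)) e0.
have d1 : is_derive t 1 (fun s => A s 1 - B t 1 * s) (d - B t 1).
  by apply: is_derive_eq; rewrite /GRing.scale /= mulr1.
apply: (is_derive_lip d1 (_ : 0 < Num.min r t)); first by rewrite lt_min r0.
move=> h; rewrite lt_min => /andP[hr1 hr2].
pose X x := A (t + h) x - A t x - B t 1 * h.
have -> : A (t + h) 1 - B t 1 * (t + h) - (A t 1 - B t 1 * t) = X 1 by rewrite /X; ring.
have cX : continuous X.
  apply: contD; last by apply: contN; exact: cont_cst.
  by apply: contD; [|apply: contN]; exact: (continuous_slice2 cA).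
apply/ler_addgt0Pr => eta eta0.
have /cvgrPdist_le /(_ _ eta0) [q /= q0 hq] := cX 1.
pose m := Num.min (Num.min r q) 1 / 2.
have [m0 [mr [mq m1]]] : 0 < m /\ (2 * m <= r /\ (2 * m <= q /\ 2 * m <= 1)).
  have -> : 2 * m = Num.min (Num.min r q) 1 by rewrite /m; field.
  by rewrite !ge_min !lexx !orbT /=; split => //; rewrite /m divr_gt0 // !lt_min r0 q0 ltr01.
pose x := 1 - m.
have x01 : 0 < x < 1 by rewrite /x; lra.
have mm : 1 - x = m by rewrite /x; ring.
have h1 : `|X 1 - X x| <= eta by apply: hq; rewrite /= mm gtr0_norm //; lra.
suff h2 : `|X x| <= e * `|h| by have := ler_distD (X x) (X 1) 0; rewrite !subr0; lra.
have -> : X x = (A (t + h) x - B t 1 * (t + h)) - (A t x - B t 1 * t) by rewrite /X; ring.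
apply: (@le_increment _ (fun s => A s x - B t 1 * s) (fun s => B s x - B t 1)) => s hs.
  have s0 : 0 < s by move: (le_lt_trans hs hr2); rewrite ltr_norml; lra.
  have d2 := dA s x s0 x01.
  by apply: is_derive_eq; rewrite /GRing.scale /= mulr1.
apply: hr; first exact: le_lt_trans hr1.
by rewrite -normrN opprB mm gtr0_norm //; lra.
Qed.

(** The differentiated equations come from [mixed_derivative]; the condition u_x = k v_x at x = 1
    comes from replacing u_t by - v_x there. *)
Lemma global_solution_classical (S : R -> R -> R) F dF g kap k (u0 v0 : jet R)
    (u v : R -> jet R) :
  (forall a b, S a b = kap * (F a - b)) ->
  (forall x, is_derive x 1 F (dF x)) -> continuous dF -> smooth g ->
  global_solution S g k u0 v0 u v -> classical_solution F dF g kap k (ext u) (ext v).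
Proof.
move=> SE hF cdF sg [hu hv heq _ hbc].
have cu i (i3 : (i < 3)%N) := ext_continuous hu i3.
have cv i (i3 : (i < 3)%N) := ext_continuous hv i3.
have ux i t x : (i < 2)%N -> 0 < x < 1 -> is_derive x 1 (ext u i t) (ext u i.+1 t x).
  by move=> i2 x01; exact: ext_dx.
have vx i t x : (i < 2)%N -> 0 < x < 1 -> is_derive x 1 (ext v i t) (ext v i.+1 t x).
  by move=> i2 x01; exact: ext_dx.
have near0 (w : R -> jet R) t x d : 0 < t -> 0 <= x <= 1 ->
    is_derive t 1 (fun s => w s 0%N x) d -> is_derive t 1 (ext w 0%N ^~ x) d.
  move=> t0 x01; apply: is_derive_near t0 _ => y hy.
  by rewrite extE //; move: hy; rewrite ltr_norml; lra.
have u0t t x : 0 < t -> 0 < x < 1 -> is_derive t 1 (ext u 0%N ^~ x) (- ext v 1%N t x).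
  move=> t0 x01; have [d _] := heq t x t0 x01; have x01' : 0 <= x <= 1 by lra.
  by rewrite extE ?(ltW t0) //; exact: near0.
have v0t t x : 0 < t -> 0 < x < 1 -> is_derive t 1 (ext v 0%N ^~ x)
    (kap * (F (ext u 0%N t x) - ext v 0%N t x) - g (ext u 1%N t x) * ext u 1%N t x).
  move=> t0 x01; have [_ d] := heq t x t0 x01; have x01' : 0 <= x <= 1 by lra.
  by rewrite !extE ?(ltW t0) // -SE; exact: near0.
(* [mixed_derivative] needs the first-order equations in a full neighbourhood, which must stay in
   positive times and in the open interval. *)
have inside t x s y : 0 < t -> 0 < x < 1 -> `|s - t| < Num.min t (Num.min x (1 - x)) ->
    `|y - x| < Num.min t (Num.min x (1 - x)) -> 0 < s /\ 0 < y < 1.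
  by move=> t0 x01; rewrite !lt_min !ltr_norml; lra.
have pos t x : 0 < t -> 0 < x < 1 -> 0 < Num.min t (Num.min x (1 - x)).
  by move=> t0 x01; rewrite !lt_min; lra.
have cF : continuous F by move=> x; exact: is_derive_continuous (hF x).
split => //.
- move=> t x t0 x01.
  apply: (@mixed_derivative R (ext u 0%N) (fun t x => - ext v 1%N t x) (ext u 1%N)
    (fun t x => - ext v 2%N t x) t x _ (pos t x t0 x01)).
    move=> s y hs hy; have [s0 y01] := inside t x s y t0 x01 hs hy.
    split; [exact: u0t|exact: ux|].
    by have d := vx 1%N s y isT y01; exact: is_deriveN.
  by apply: contN; exact: cv.
- move=> t x t0 x01.
  pose B t x := kap * (F (ext u 0%N t x) - ext v 0%N t x) - g (ext u 1%N t x) * ext u 1%N t x.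
  pose Bx t x := kap * (dF (ext u 0%N t x) * ext u 1%N t x - ext v 1%N t x) -
    hfun g (ext u 1%N t x) * ext u 2%N t x.
  apply: (@mixed_derivative R (ext v 0%N) B (ext v 1%N) Bx t x _ (pos t x t0 x01)).
    move=> s y hs hy; have [s0 y01] := inside t x s y t0 x01 hs hy.
    split; [exact: v0t|exact: vx|].
    have d1 := ux 0%N s y isT y01; have d2 := ux 1%N s y isT y01.
    have d3 := vx 0%N s y isT y01.
    have d4 := @is_derive1_comp R F (ext u 0%N s) y _ _ (hF _) d1.
    have d5 := @is_derive1_comp R (fun s => g s * s) (ext u 1%N s) y _ _ (is_derive_flux _ sg) d2.
    have d6 : is_derive y 1 (fun y => F (ext u 0%N s y)) (dF (ext u 0%N s y) * ext u 1%N s y) by [].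
    have d7 : is_derive y 1 (fun y => g (ext u 1%N s y) * ext u 1%N s y)
      (hfun g (ext u 1%N s y) * ext u 2%N s y) by [].
    exact: (is_deriveB (is_deriveZ kap (is_deriveB d6 d3)) d7).
  apply: contD; first (apply: contM; first exact: cont_cst).
    apply: contD; last by apply: contN; exact: cv.
    by apply: contM; [apply: (cont_comp cdF); exact: cu|exact: cu].
  apply/contN/contM; last exact: cu.
  by apply: (cont_comp (hfun_continuous sg)); exact: cu.
- by move=> t t0; have [b _ _] := hbc t t0; rewrite extE ?lexx ?ler01 // ltW.
- move=> t t0; have [_ b1 b2] := hbc t t0.
  have h01 : 0 <= (1 : R) <= 1 by lra.
  rewrite !extE ?(ltW t0) // b2.
  have d1 := near0 u t 1 _ t0 h01 (derivable_is_derive b1).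
  have cv' : continuous (fun z : R * R => - ext v 1%N z.1 z.2) by apply: contN; exact: cv.
  have := boundary_time_derivative t0 (cu 0%N isT) cv' u0t d1.
  by rewrite extE ?(ltW t0) // => ->; ring.
Qed.

Lemma C0H3_shift (u : R -> jet R) c : C0H3 u -> C0H3 (fun t => u t - jconst c).
Proof.
move=> [uH uC]; split=> [t t0|t0 t00].
  by apply: inHB; [exact: uH|exact: inH_jconst].
have -> : (fun t => Hnorm 3 (u t - jconst c - (u t0 - jconst c))) =
    (fun t => Hnorm 3 (u t - u t0)); last exact: uC.
by apply/funext => t; congr Hnorm; rewrite opprB addrA subrK.
Qed.

(** System (L) sees u and v only through their derivatives, so constants may be subtracted; this
    turns solutions of (L) into solutions of (H). *)
Lemma global_solution_shift g k (u0 v0 : jet R) (u v : R -> jet R) a b :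
  global_solution no_source g k u0 v0 u v ->
  global_solution no_source g k (u0 - jconst a) (v0 - jconst b)
    (fun t => u t - jconst a) (fun t => v t - jconst b).
Proof.
have shift (w : R -> jet R) c t x : (w t - jconst c) 1%N x = w t 1%N x by exact: subr0.
have shiftd (w : R -> jet R) c t x d : is_derive t 1 (fun s => w s 0%N x) d ->
    is_derive t 1 (fun s => (w s - jconst c) 0%N x) d.
  move=> dw; have dc := is_derive_cst (c : R) t (1 : R).
  by have := is_deriveB dw dc; rewrite subr0.
move=> [hu hv heq hinit hbc]; split; try exact: C0H3_shift.
- move=> t x t0 x01; rewrite !shift; have [d1 d2] := heq t x t0 x01.
  by split; apply: shiftd.
- move=> x x01; have [e1 e2] := hinit x x01.
  split; [exact: (congr1 (fun z => z - a) e1)|exact: (congr1 (fun z => z - b) e2)].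
- move=> t t0; have [b1 b2 b3] := hbc t t0; rewrite !shift.
  have d := shiftd u a t 1 _ (derivable_is_derive b2).
  by split=> //; rewrite (is_derive_derive1 d).
Qed.

End ClassicalSolutions.

(** * Energy estimate *)

Section PointwiseEnergy.
Context {R : realType}.
Implicit Types (a b ax p q r kp x kap dl A B : R).

Lemma le_mul_norm (x y A B : R) : `|x| <= A -> `|y| <= B -> x * y <= A * B.
Proof.
move=> xA yB; apply: le_trans (ler_norm _) _; rewrite normrM.
by apply: ler_pM.
Qed.

(** Gathers the terms of the energy identity that have no sign. Each carries a factor [A] or [B],
    which will decay in time, so Young's inequality is enough. *)
Lemma energy_error ax b p q r kp x kap A B :
  0 <= x <= 1 -> 0 <= kp <= 1 / 2 -> 0 <= A -> 0 <= B -> 0 <= kap ->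
  `|ax| <= A -> `|b| <= A -> `|r| <= B * kap + A * `|p| ->
  ax * (p * q) + b * (p ^+ 2 / 2) - kp * x * ax * (p ^+ 2 / 2) + (q - kp * x * p) * r
  <= (4 * A + B) * (p ^+ 2 + q ^+ 2 + kap ^+ 2).
Proof.
move=> /andP[x0 x1] /andP[k0 k1] A0 B0 kap0 hax hat hr.
have kx : 0 <= kp * x <= 1 by rewrite mulr_ge0 //=; nra.
have P2 : p ^+ 2 = `|p| ^+ 2 by rewrite real_normK ?num_real.
have Q2 : q ^+ 2 = `|q| ^+ 2 by rewrite real_normK ?num_real.
set P := `|p| in P2 hr *; set Q := `|q| in Q2 *.
have P0 : 0 <= P := normr_ge0 p; have Q0 : 0 <= Q := normr_ge0 q.
have b1 : ax * (p * q) <= A * (P * Q) by apply: le_mul_norm => //; rewrite normrM.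
have np2 : `|p ^+ 2 / 2| <= P ^+ 2 / 2 by rewrite -P2 ger0_norm // divr_ge0 // sqr_ge0.
have b2 : b * (p ^+ 2 / 2) <= A * (P ^+ 2 / 2) by exact: le_mul_norm.
have b3 : - (kp * x * ax) * (p ^+ 2 / 2) <= A * (P ^+ 2 / 2).
  apply: le_mul_norm => //; rewrite normrN normrM ger0_norm; last by case/andP: kx.
  by apply: le_trans hax; rewrite ler_piMl //; case/andP: kx.
have b4 : (q - kp * x * p) * r <= (Q + P) * (B * kap + A * P).
  apply: le_mul_norm => //; apply: le_trans (ler_normB _ _) _; rewrite lerD2l.
  by rewrite normrM ger0_norm ?ler_piMl //; case/andP: kx.
have c1 : P * Q <= P ^+ 2 + Q ^+ 2 by have := sqr_ge0 (P - Q); nra.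
have c2 : (Q + P) * kap <= P ^+ 2 + Q ^+ 2 + kap ^+ 2.
  by have := sqr_ge0 (P - kap); have := sqr_ge0 (Q - kap); nra.
have c3 : (Q + P) * P <= 2 * (P ^+ 2 + Q ^+ 2) by have := sqr_ge0 (P - Q); nra.
have d1 := ler_wpM2l A0 c1; have d2 := ler_wpM2l B0 c2; have d3 := ler_wpM2l A0 c3.
have d4 : 0 <= A * Q ^+ 2 by rewrite mulr_ge0 ?sqr_ge0.
have d5 : 0 <= A * kap ^+ 2 by rewrite mulr_ge0 ?sqr_ge0.
have d6 : (Q + P) * (B * kap + A * P) = B * ((Q + P) * kap) + A * ((Q + P) * P) by ring.
rewrite P2 in b2 b3 *; rewrite Q2; rewrite d6 in b4.
have d7 : - (kp * x * ax) * (P ^+ 2 / 2) = - (kp * x * ax * (P ^+ 2 / 2)) by ring.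
by rewrite d7 in b3; lra.
Qed.

(** The cross term costs at most a quarter of [q ^+ 2 + a * p ^+ 2]: [kp <= 1 / 2] pays for its
    q-part, and [kp <= dl / 2] with [dl <= a] for its p-part. *)
Lemma energy_equiv a p q kp x dl : 0 < dl -> dl <= a -> 0 <= x <= 1 ->
  0 <= kp -> kp <= 1 / 2 -> kp <= dl / 2 ->
  (q ^+ 2 + a * p ^+ 2) / 4 <= q ^+ 2 / 2 + a * p ^+ 2 / 2 - kp * x * (p * q)
    <= 3 / 4 * (q ^+ 2 + a * p ^+ 2).
Proof.
move=> dl0 da /andP[x0 x1] k0 k1 k2.
suff : `|kp * x * (p * q)| <= (q ^+ 2 + a * p ^+ 2) / 4.
  by rewrite ler_norml; lra.
rewrite normrM (ger0_norm (mulr_ge0 k0 x0)) normrM.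
have -> : p ^+ 2 = `|p| ^+ 2 by rewrite real_normK ?num_real.
have -> : q ^+ 2 = `|q| ^+ 2 by rewrite real_normK ?num_real.
have P0 := normr_ge0 p; have Q0 := normr_ge0 q.
move: `|p| `|q| P0 Q0 => P Q P0 Q0.
apply: (@le_trans _ _ (kp * (P * Q))).
  by rewrite ler_wpM2r ?mulr_ge0 // ler_piMr.
apply: (@le_trans _ _ (kp * (P ^+ 2 / 2) + kp * (Q ^+ 2 / 2))).
  by rewrite -mulrDr ler_wpM2l //; have := sqr_ge0 (P - Q); nra.
have p2 := sqr_ge0 P; have q2 := sqr_ge0 Q.
have := ler_wpM2r p2 k2; have := ler_wpM2r q2 k1; have := ler_wpM2r p2 da; lra.
Qed.

(** With p = k q the flux is [q ^+ 2 / 2] times an affine function of [a]. The condition on [kp]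
    makes this function nonpositive at [a = dl] and also makes its slope [kp * k ^+ 2 - 2 * k]
    nonpositive, so every larger [a] is covered. *)
Lemma boundary_flux_le0 a q k kp dl : 0 < dl -> dl <= a -> 0 < k -> 0 < kp ->
  kp * (1 + dl * k ^+ 2) <= 2 * dl * k ->
  - (a * (k * q) * q) + kp * 1 * (q ^+ 2 + a * (k * q) ^+ 2) / 2 <= 0.
Proof.
move=> dl0 da k0 kp0 hk.
have -> : - (a * (k * q) * q) + kp * 1 * (q ^+ 2 + a * (k * q) ^+ 2) / 2 =
  (kp + kp * a * k ^+ 2 - 2 * a * k) * q ^+ 2 / 2 by field.
suff h : kp + kp * a * k ^+ 2 - 2 * a * k <= 0 by have := sqr_ge0 q; nra.
have h1 : 0 <= 2 * k - kp * k ^+ 2 by rewrite -(pmulr_rge0 _ dl0); lra.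
have := ler_wpM2r h1 da; lra.
Qed.

End PointwiseEnergy.

Ltac cont_arith := lazymatch goal with
  | |- continuous (fun z => @?F z + @?G z) => apply: (@contD _ _ F G); cont_arith
  | |- continuous (fun z => - @?F z) => apply: (@contN _ _ F); cont_arith
  | |- continuous (fun z => @?F z * @?G z) => apply: (@contM _ _ F G); cont_arith
  | |- continuous (fun z => @?F z ^+ ?n) => apply: (@contX _ _ F n); cont_arith
  | |- _ => first [assumption | exact: cont_cst]
  end.

(** * Calculus of the energy density and its flux *)

Section EnergyCalculus.
Context {R : realType}.

Lemma continuous_energy {T : topologicalType} (kp : R) (x p q a : T -> R) :
  continuous x -> continuous p -> continuous q -> continuous a ->
  continuous (fun z => q z ^+ 2 / 2 + a z * p z ^+ 2 / 2 - kp * x z * (p z * q z)).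
Proof.
move=> cx cp cq ca; cont_arith.
Qed.

Lemma continuous_energy_dt {T : topologicalType} (kp : R) (x p q px qx a b r : T -> R) :
  continuous x -> continuous p -> continuous q -> continuous px -> continuous qx ->
  continuous a -> continuous b -> continuous r ->
  continuous (fun z => q z * (r z - a z * px z) + b z * p z ^+ 2 / 2 +
    a z * (p z * - qx z) - kp * x z * (- qx z * q z + p z * (r z - a z * px z))).
Proof.
move=> cx cp cq cpx cqx ca cb cr; cont_arith.
Qed.

Lemma continuous_flux {T : topologicalType} (kp : R) (x p q a : T -> R) :
  continuous x -> continuous p -> continuous q -> continuous a ->
  continuous (fun z => - (a z * p z * q z) + kp * x z * (q z ^+ 2 + a z * p z ^+ 2) / 2).
Proof.
move=> cx cp cq ca; cont_arith.
Qed.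

Lemma continuous_flux_dx {T : topologicalType} (kp : R) (x p q px qx a ax : T -> R) :
  continuous x -> continuous p -> continuous q -> continuous px -> continuous qx ->
  continuous a -> continuous ax ->
  continuous (fun z => - (ax z * p z * q z + a z * px z * q z + a z * p z * qx z) +
    kp * (q z ^+ 2 + a z * p z ^+ 2) / 2 +
    kp * x z * (2 * q z * qx z + ax z * p z ^+ 2 + 2 * a z * p z * px z) / 2).
Proof.
move=> cx cp cq cpx cqx ca cax; cont_arith.
Qed.

Lemma is_derive_energy (kp x t : R) (p q a : R -> R) (p' q' a' : R) :
  is_derive t 1 p p' -> is_derive t 1 q q' -> is_derive t 1 a a' ->
  is_derive t 1 (fun s => q s ^+ 2 / 2 + a s * p s ^+ 2 / 2 - kp * x * (p s * q s))
    (q t * q' + a' * p t ^+ 2 / 2 + a t * (p t * p') - kp * x * (p' * q t + p t * q')).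
Proof.
by move=> dp dq da; apply: is_derive_eq; rewrite /GRing.scale /=; field.
Qed.

Lemma is_derive_flux_dx (kp x : R) (p q a : R -> R) (p' q' a' : R) :
  is_derive x 1 p p' -> is_derive x 1 q q' -> is_derive x 1 a a' ->
  is_derive x 1 (fun s => - (a s * p s * q s) + kp * s * (q s ^+ 2 + a s * p s ^+ 2) / 2)
    (- (a' * p x * q x + a x * p' * q x + a x * p x * q') +
    kp * (q x ^+ 2 + a x * p x ^+ 2) / 2 +
    kp * x * (2 * q x * q' + a' * p x ^+ 2 + 2 * a x * p x * p') / 2).
Proof.
by move=> dp dq da; apply: is_derive_eq; rewrite /GRing.scale /=; field.
Qed.

End EnergyCalculus.

(** * Decay of the energy and control of the means *)

Section Energy.
Context {R : realType} {f df g dh : R -> R} {k dl N M mu H0 H1 : R}.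
Notation mu_ := (@lebesgue_measure R).
Notation I := (@I01 R).
Local Hint Resolve measurable_I01 : core.
Local Notation h := (hfun g).

Context (k_gt0 : 0 < k) (dl_gt0 : 0 < dl) (N_ge0 : 0 <= N) (M_ge0 : 0 <= M)
  (mu_gt0 : 0 < mu) (H1_ge0 : 0 <= H1).
Context (h_ge : forall s, dl <= h s) (h_cont : continuous h)
  (h_der : forall x : R, is_derive x 1 h (dh x)) (dh_cont : continuous dh)
  (dh_le : forall s, `|s| <= 3 * N -> `|dh s| <= H1)
  (h_le : forall s, `|s| <= 3 * N -> h s <= H0)
  (df_cont : continuous df) (df_le : forall s, `|df s| <= M).

Context {kap : R} {U V Uh Vh : nat -> R -> R -> R} (kap_ge0 : 0 <= kap)
  (sol : classical_solution f df g kap k U V)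
  (solh : classical_solution f df g 0 k Uh Vh).

(** Order zero is excluded: u and v themselves need not tend to 0. *)
Definition decaying (W : nat -> R -> R -> R) := forall i t x,
  (0 < i < 3)%N -> 0 <= t -> 0 <= x <= 1 -> `|W i t x| <= N * expR (- mu * t).

Context (bU : decaying U) (bV : decaying V) (bUh : decaying Uh).

Lemma expR_le1 t : 0 <= t -> expR (- mu * t) <= 1.
Proof.
by move=> t0; rewrite -expR0 ler_expR mulNr oppr_le0 mulr_ge0 // ltW.
Qed.

Lemma decaying_le W i t x : decaying W -> (0 < i < 3)%N -> 0 <= t -> 0 <= x <= 1 ->
  `|W i t x| <= N.
Proof.
move=> bW i3 t0 x01; apply: le_trans (bW i t x i3 t0 x01) _.
by rewrite ler_piMr ?expR_le1.
Qed.

(** Points between [s] and [s'] lie within [2 * N] of [s']; hence the radius [3 * N] in the bounds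
    [H0] and [H1]. *)
Lemma h_lip s s' : `|s| <= N -> `|s'| <= N -> `|h s - h s'| <= H1 * `|s - s'|.
Proof.
move=> sN s'N; have := @le_increment R h dh s' (s - s') H1.
rewrite [s' + _]addrC subrK; apply => y hy //; apply: dh_le.
have := ler_normD (y - s') s'; rewrite subrK; have := ler_normB s s'; lra.
Qed.

(* Largest multiplier for which the boundary term at [x = 1] is dissipative and
   the energy remains equivalent to the squared L2 norm. *)
Definition multiplier : R :=
  Num.min (Num.min (1 / 2) (dl / 2)) (2 * dl * k / (1 + dl * k ^+ 2)).
Local Notation kp := multiplier.

Lemma multiplierP : [/\ 0 < kp, kp <= 1 / 2, kp <= dl / 2 &
  kp * (1 + dl * k ^+ 2) <= 2 * dl * k].
Proof.
have d0 : 0 < 1 + dl * k ^+ 2 by rewrite ltr_pwDl // mulr_ge0 ?sqr_ge0 // ltW.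
split.
- by rewrite !lt_min !divr_gt0 // !mulr_gt0.
- by rewrite !ge_min lexx.
- by rewrite !ge_min lexx !orbT.
- by rewrite -ler_pdivlMr // !ge_min lexx !orbT.
Qed.

Let p t x := U 1%N t x - Uh 1%N t x.
Let q t x := V 1%N t x - Vh 1%N t x.
Let px t x := U 2%N t x - Uh 2%N t x.
Let qx t x := V 2%N t x - Vh 2%N t x.
Let a t x := h (U 1%N t x).
Let ax t x := dh (U 1%N t x) * U 2%N t x.
Let b t x := - (dh (U 1%N t x) * V 2%N t x).
(** Splitting h(u_x) u_xx - h(uh_x) uh_xx in this way leaves the coefficient of p_x at the solution
    of (P) and makes the rest linear in p, with the decaying factor uh_xx. *)
Let r t x := kap * (df (U 0%N t x) * U 1%N t x - V 1%N t x) -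
  (h (U 1%N t x) - h (Uh 1%N t x)) * Uh 2%N t x.
Let e t x := q t x ^+ 2 / 2 + a t x * p t x ^+ 2 / 2 - kp * x * (p t x * q t x).
Let de t x := q t x * (r t x - a t x * px t x) + b t x * p t x ^+ 2 / 2 +
  a t x * (p t x * - qx t x) -
  kp * x * (- qx t x * q t x + p t x * (r t x - a t x * px t x)).
(** Chosen so that e_t - flux_x is - kp (q^2 + a p^2) / 2 plus the terms of [energy_error]. The
    damping arises from differentiating the weight x. *)
Let flux t x := - (a t x * p t x * q t x) +
  kp * x * (q t x ^+ 2 + a t x * p t x ^+ 2) / 2.
Let dflux t x := - (ax t x * p t x * q t x + a t x * px t x * q t x +
    a t x * p t x * qx t x) +
  kp * (q t x ^+ 2 + a t x * p t x ^+ 2) / 2 +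
  kp * x * (2 * q t x * qx t x + ax t x * p t x ^+ 2 + 2 * a t x * p t x * px t x) / 2.

Let cU i : (i < 3)%N -> continuous (fun z : R * R => U i z.1 z.2) := cs_contU sol (i := i).
Let cV i : (i < 3)%N -> continuous (fun z : R * R => V i z.1 z.2) := cs_contV sol (i := i).
Let cUh i : (i < 3)%N -> continuous (fun z : R * R => Uh i z.1 z.2) := cs_contU solh (i := i).
Let cVh i : (i < 3)%N -> continuous (fun z : R * R => Vh i z.1 z.2) := cs_contV solh (i := i).

Let cx : continuous (fun z : R * R => z.2).
Proof. by move=> z; exact: cvg_snd. Qed.

Let cp : continuous (fun z : R * R => p z.1 z.2).
Proof. by apply: contD; [exact: cU|apply: contN; exact: cUh]. Qed.
Let cq : continuous (fun z : R * R => q z.1 z.2).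
Proof. by apply: contD; [exact: cV|apply: contN; exact: cVh]. Qed.
Let cpx : continuous (fun z : R * R => px z.1 z.2).
Proof. by apply: contD; [exact: cU|apply: contN; exact: cUh]. Qed.
Let cqx : continuous (fun z : R * R => qx z.1 z.2).
Proof. by apply: contD; [exact: cV|apply: contN; exact: cVh]. Qed.
Let ca : continuous (fun z : R * R => a z.1 z.2).
Proof. by apply: (cont_comp h_cont); exact: cU. Qed.
Let cax : continuous (fun z : R * R => ax z.1 z.2).
Proof. by apply: contM; [apply: (cont_comp dh_cont); exact: cU|exact: cU]. Qed.
Let cb : continuous (fun z : R * R => b z.1 z.2).
Proof. by apply: contN; apply: contM; [apply: (cont_comp dh_cont); exact: cU|exact: cV]. Qed.
Let cr : continuous (fun z : R * R => r z.1 z.2).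
Proof.
apply: contD.
  apply: contM; first exact: cont_cst.
  apply: contD; last by apply: contN; exact: cV.
  by apply: contM; [apply: (cont_comp df_cont); exact: cU|exact: cU].
apply/contN/contM; last exact: cUh.
by apply: contD; [exact: ca|apply/contN/(cont_comp h_cont); exact: cUh].
Qed.

Let ce : continuous (fun z : R * R => e z.1 z.2).
Proof. exact: continuous_energy. Qed.
Let cde : continuous (fun z : R * R => de z.1 z.2).
Proof. exact: continuous_energy_dt. Qed.
Let cflux : continuous (fun z : R * R => flux z.1 z.2).
Proof. exact: continuous_flux. Qed.
Let cdflux : continuous (fun z : R * R => dflux z.1 z.2).
Proof. exact: continuous_flux_dx. Qed.

Let pt (t x : R) : 0 < t -> 0 < x < 1 -> is_derive t 1 (p ^~ x) (- qx t x).
Proof.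
move=> t0 x01; have d1 := cs_U1t sol t0 x01; have d2 := cs_U1t solh t0 x01.
by have := is_deriveB d1 d2; rewrite -opprD.
Qed.

Let qt (t x : R) : 0 < t -> 0 < x < 1 -> is_derive t 1 (q ^~ x) (r t x - a t x * px t x).
Proof.
move=> t0 x01; have d1 := cs_V1t sol t0 x01; have d2 := cs_V1t solh t0 x01.
apply: (is_derive_eq (is_deriveB d1 d2)); rewrite /r /a /px; ring.
Qed.

Let at_ (t x : R) : 0 < t -> 0 < x < 1 -> is_derive t 1 (a ^~ x) (b t x).
Proof.
move=> t0 x01; have d1 := cs_U1t sol t0 x01.
apply: (is_derive_eq (@is_derive1_comp R h (U 1%N ^~ x) t _ _ (h_der _) d1)).
by rewrite /b mulrN.
Qed.

Let et (t x : R) : 0 < t -> 0 < x < 1 -> is_derive t 1 (e ^~ x) (de t x).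
Proof.
by move=> t0 x01; exact: is_derive_energy (pt t0 x01) (qt t0 x01) (at_ t0 x01).
Qed.

Let flux_x (t x : R) : 0 < x < 1 -> is_derive x 1 (flux t) (dflux t x).
Proof.
move=> x01.
have d1 : is_derive x 1 (p t) (px t x).
  exact: (is_deriveB (cs_Ux (i := 1) sol t isT x01) (cs_Ux (i := 1) solh t isT x01)).
have d2 : is_derive x 1 (q t) (qx t x).
  exact: (is_deriveB (cs_Vx (i := 1) sol t isT x01) (cs_Vx (i := 1) solh t isT x01)).
have d3 : is_derive x 1 (a t) (ax t x).
  exact: (@is_derive1_comp R h (U 1%N t) x _ _ (h_der _) (cs_Ux (i := 1) sol t isT x01)).
exact: is_derive_flux_dx d1 d2 d3.
Qed.

Let C1 : R := (4 * H1 + (M + 1)) * N.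

Let energy_pointwise (t x : R) : 0 < t -> 0 < x < 1 ->
  de t x <= dflux t x - kp / 2 * (q t x ^+ 2 + a t x * p t x ^+ 2) +
    C1 * expR (- mu * t) * (p t x ^+ 2 + q t x ^+ 2 + kap ^+ 2).
Proof.
move=> t0 x01; have x01' : 0 <= x <= 1 by lra.
have t0' := ltW t0; have [kp0 kp1 _ _] := multiplierP.
set m := expR (- mu * t); have m0 : 0 < m := expR_gt0 _.
have N0 := N_ge0; have nU := decaying_le bU (isT : (0 < 1 < 3)%N) t0' x01'.
have nUh := decaying_le bUh (isT : (0 < 1 < 3)%N) t0' x01'.
have hax : `|ax t x| <= H1 * (N * m).
  by rewrite normrM ler_pM // //; [apply: dh_le; lra|exact: bU].
have hb : `|b t x| <= H1 * (N * m).
  by rewrite normrN normrM ler_pM // //; [apply: dh_le; lra|exact: bV].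
have hr : `|r t x| <= (M + 1) * (N * m) * kap + H1 * (N * m) * `|p t x|.
  apply: le_trans (ler_normB _ _) _; apply: lerD.
    rewrite normrM (ger0_norm kap_ge0) mulrC ler_wpM2r //.
    apply: le_trans (ler_normB _ _) _; rewrite mulrDl mul1r.
    apply: lerD; last exact: bV.
    by rewrite normrM ler_pM //; exact: bU.
  rewrite normrM mulrAC ler_pM //; last exact: bUh.
  exact: h_lip.
have Nm0 : 0 <= N * m by rewrite mulr_ge0 // ltW.
have kp01 : 0 <= kp <= 1 / 2 by rewrite (ltW kp0).
have EE := @energy_error R _ _ _ (q t x) _ _ _ _ _ _ x01' kp01 (mulr_ge0 H1_ge0 Nm0)
  (mulr_ge0 (addr_ge0 M_ge0 ler01) Nm0) kap_ge0 hax hb hr.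
have Cm : 4 * (H1 * (N * m)) + (M + 1) * (N * m) = C1 * m by rewrite /C1; ring.
rewrite Cm in EE.
apply: (@le_trans _ _ (dflux t x - kp / 2 * (q t x ^+ 2 + a t x * p t x ^+ 2) +
  (ax t x * (p t x * q t x) + b t x * (p t x ^+ 2 / 2)
   - kp * x * ax t x * (p t x ^+ 2 / 2) + (q t x - kp * x * p t x) * r t x))); last by rewrite lerD2l.
by rewrite le_eqVlt /de /dflux; apply/orP; left; apply/eqP; field.
Qed.


(** The quarter is the lower constant of [energy_equiv]; the minimum serves q^2 and a p^2 >= dl p^2
    at once. *)
Definition coercivity : R := Num.min 1 dl / 4.
Local Notation c0 := coercivity.

Lemma coercivityP : [/\ 0 < c0, c0 <= 1 / 4 & c0 <= dl / 4].
Proof.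
have h1 : Num.min 1 dl <= 1 by rewrite ge_min lexx.
have h2 : Num.min 1 dl <= dl by rewrite ge_min lexx orbT.
rewrite /coercivity; split; [|lra|lra].
by rewrite divr_gt0 // lt_min ltr01.
Qed.

Definition growth : R := C1 / c0.
Local Notation c1 := growth.
(** The dissipation [kp / 2] divided by the upper constant 3/4 of [energy_equiv]. *)
Definition damping : R := 2 * kp / 3.
Local Notation l := damping.

Let C1_ge0 : 0 <= C1.
Proof. by rewrite mulr_ge0 // addr_ge0 ?mulr_ge0 // addr_ge0. Qed.

Lemma growthP : 0 <= c1 /\ C1 <= c1.
Proof.
have [c00 c01 _] := coercivityP; split; first by rewrite divr_ge0 // ltW.
by rewrite ler_pdivlMr // ler_piMr //; lra.
Qed.

Let energy_bounds t x : 0 <= t -> 0 <= x <= 1 ->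
  [/\ c0 * (p t x ^+ 2 + q t x ^+ 2) <= e t x,
      e t x <= 3 / 4 * (q t x ^+ 2 + a t x * p t x ^+ 2) &
      e t x <= (1 + H0) * (p t x ^+ 2 + q t x ^+ 2)].
Proof.
move=> t0 x01; have [kp0 kp1 kp2 _] := multiplierP.
have [c00 c01 c02] := coercivityP.
have ad : dl <= a t x := h_ge _.
have /andP[e1 e2] := energy_equiv (p t x) (q t x) dl_gt0 ad x01
  (ltW kp0) kp1 kp2.
have aH : a t x <= H0.
  apply: h_le; have := decaying_le bU (isT : (0 < 1 < 3)%N) t0 x01; have := N_ge0; lra.
have d0 := dl_gt0.
have p2 := sqr_ge0 (p t x); have q2 := sqr_ge0 (q t x).
split => //.
- apply: le_trans e1; have := ler_wpM2r p2 ad; have := ler_wpM2r p2 c02.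
  have := ler_wpM2r q2 c01; lra.
- apply: le_trans e2 _; have := ler_wpM2r p2 aH.
  have : 0 <= H0 * q t x ^+ 2 by rewrite mulr_ge0 //; lra.
  have : 0 <= a t x * p t x ^+ 2 by rewrite mulr_ge0 // (le_trans _ ad) // ltW.
  by lra.
Qed.

Let E t := \int[mu_]_(x in I) e t x.
Let dE t := \int[mu_]_(x in I) de t x.

Let dE_le t : 0 < t ->
  dE t <= - l * E t + c1 * expR (- mu * t) * E t + c1 * expR (- mu * t) * kap ^+ 2.
Proof.
move=> t0; set m := expR (- mu * t); have m0 : 0 < m := expR_gt0 _.
have [c00 c01 _] := coercivityP; have [c10 C1c1] := growthP.
have [kp0 _ _ kp3] := multiplierP.
have ie : mu_.-integrable I (EFin \o e t).
  by apply: continuous_integrable; exact: (continuous_slice2 ce).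
have ide : mu_.-integrable I (EFin \o de t).
  by apply: continuous_integrable; exact: (continuous_slice2 cde).
have idf : mu_.-integrable I (EFin \o dflux t).
  by apply: continuous_integrable; exact: (continuous_slice2 cdflux).
have icst c : mu_.-integrable I (EFin \o cst c) by exact/continuous_integrable/cont_cst.
have iZ : mu_.-integrable I (EFin \o (fun x => (- l + c1 * m) * e t x)).
  exact: (integrableZl measurable_I01 _ ie).
have iS : mu_.-integrable I (EFin \o (fun x => dflux t x + (- l + c1 * m) * e t x)).
  exact: (integrableD measurable_I01 idf iZ).
(* At x = 0 both p and the weight x vanish; at x = 1 one has p = k q and the flux has a sign. *)
have F0 : \int[mu_]_(x in I) dflux t x <= 0.
  have -> := FTC_I01 (continuous_slice2 (t := t) cflux) (continuous_slice2 (t := t) cdflux)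
    (@flux_x t).
  rewrite /flux /p /a (cs_left sol t0) (cs_left solh t0) (cs_right sol t0) (cs_right solh t0).
  rewrite subrr !mulr0 !mul0r oppr0 add0r subr0 -mulrBr -/(q t 1).
  by apply: (@boundary_flux_le0 R _ _ _ _ dl) => //; exact: h_ge.
apply: (@le_trans _ _ (\int[mu_]_(x in I)
    (dflux t x + (- l + c1 * m) * e t x + cst (c1 * m * kap ^+ 2) x))).
  apply: le_Rintegral => //.
    exact: (integrableD measurable_I01 iS (icst _)).
  move=> x /I01P x01; have x01' : 0 <= x <= 1 by lra.
  apply: le_trans (energy_pointwise t0 x01) _; rewrite -/m /=.
  have [e1 e2 _] := energy_bounds (ltW t0) x01'.
  have h1 : p t x ^+ 2 + q t x ^+ 2 <= e t x / c0 by rewrite ler_pdivlMr // mulrC.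
  have h2 := ler_wpM2l (mulr_ge0 C1_ge0 (ltW m0)) h1.
  have h3 : C1 * m * (e t x / c0) = c1 * m * e t x by rewrite /growth; field; lra.
  have h4 : C1 * m * kap ^+ 2 <= c1 * m * kap ^+ 2.
    by rewrite ler_wpM2r ?sqr_ge0 // ler_wpM2r // ltW.
  have h5 := ler_wpM2l (ltW kp0) e2.
  rewrite h3 in h2; rewrite /damping; lra.
rewrite RintegralD // RintegralD // RintegralZl // Rintegral_I01_cst -/(E t); lra.
Qed.

(** Half of [mu] leaves the gap [mu - nu] that Gronwall's inequality requires. *)
Definition rate : R := Num.min (mu / 2) l.
Local Notation nu := rate.

Lemma rateP : [/\ 0 < nu, nu < mu & nu <= l].
Proof.
have [kp0 _ _ _] := multiplierP; have m0 := mu_gt0.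
have h1 : nu <= mu / 2 by rewrite /rate ge_min lexx.
split; [|lra|by rewrite /rate ge_min lexx orbT].
by rewrite lt_min /damping; apply/andP; split; lra.
Qed.

Definition gronwall_const : R := expR (c1 / mu) * (1 + c1 / (mu - nu)).
(** The initial energy is at most [(1 + H0) * (2 * D ^+ 2)]; adding [kap ^+ 2] keeps it below
    [(2 + 2 * H0) * (D + kap) ^+ 2]. Division by [c0] returns from the energy to p^2 + q^2. *)
Definition energy_const : R := gronwall_const * (2 + 2 * H0) / c0.
Local Notation Kd := energy_const.

Let H0_gt0 : 0 < H0.
Proof.
apply: lt_le_trans dl_gt0 (le_trans (h_ge 0) (h_le _)).
by rewrite normr0 mulr_ge0.
Qed.

Lemma gronwall_const_ge0 : 0 <= gronwall_const.
Proof.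
have [nu0 numu _] := rateP; have [c10 _] := growthP.
by rewrite mulr_ge0 ?expR_ge0 // addr_ge0 // divr_ge0 // subr_ge0 ltW.
Qed.

Lemma energy_const_ge0 : 0 <= Kd.
Proof.
have [c00 _ _] := coercivityP; have h0 := H0_gt0.
by rewrite divr_ge0 ?(ltW c00) // mulr_ge0 ?gronwall_const_ge0 //; lra.
Qed.

Context {D : R} (D_ge0 : 0 <= D)
  (p0_le : \int[mu_]_(x in I) (U 1%N 0 x - Uh 1%N 0 x) ^+ 2 <= D ^+ 2)
  (q0_le : \int[mu_]_(x in I) (V 1%N 0 x - Vh 1%N 0 x) ^+ 2 <= D ^+ 2).

Let energy_decay t : 0 <= t -> \int[mu_]_(x in I) (p t x ^+ 2 + q t x ^+ 2) <=
  Kd * (D + kap) ^+ 2 * expR (- nu * t).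
Proof.
move=> t0; have [c00 _ _] := coercivityP; have [nu0 numu nul] := rateP.
have [c10 _] := growthP; have h0 := H0_gt0.
have ip2 s : mu_.-integrable I (EFin \o (fun x => p s x ^+ 2)).
  by apply: continuous_integrable; apply: contX; exact: (continuous_slice2 cp).
have iq2 s : mu_.-integrable I (EFin \o (fun x => q s x ^+ 2)).
  by apply: continuous_integrable; apply: contX; exact: (continuous_slice2 cq).
have ie s : mu_.-integrable I (EFin \o e s).
  by apply: continuous_integrable; exact: (continuous_slice2 ce).
have ipq s : mu_.-integrable I (EFin \o (fun x => p s x ^+ 2 + q s x ^+ 2)).
  exact: (integrableD measurable_I01 (ip2 s) (iq2 s)).
have E_ge s : 0 <= s -> c0 * (\int[mu_]_(x in I) (p s x ^+ 2 + q s x ^+ 2)) <= E s.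
  move=> s0; rewrite -RintegralZl //; apply: le_Rintegral => //.
    exact: (integrableZl measurable_I01 _ (ipq s)).
  by move=> x /I01P x01; have [] // := @energy_bounds s x s0; lra.
have E0_le : E 0 <= (1 + H0) * (2 * D ^+ 2).
  apply: (@le_trans _ _ (\int[mu_]_(x in I) ((1 + H0) * (p 0 x ^+ 2 + q 0 x ^+ 2)))).
    apply: le_Rintegral => //.
      exact: (integrableZl measurable_I01 _ (ipq 0)).
    by move=> x /I01P x01; have [] // := @energy_bounds 0 x (lexx 0); lra.
  rewrite RintegralZl // RintegralD // ler_wpM2l //; last first.
    by rewrite mulr2n mulrDl mul1r; apply: lerD.
  by lra.
have E_ge0 s : 0 <= s -> 0 <= E s.
  move=> s0; apply: le_trans (E_ge s s0); rewrite mulr_ge0 ?(ltW c00) //.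
  by apply: Rintegral_ge0 => x _; rewrite addr_ge0 ?sqr_ge0.
have G := gronwall c10 (sqr_ge0 kap) nu0 numu nul (continuous_integral ce) E_ge0
  (fun t t0 => is_derive_integral t0 ce cde et) dE_le t0.
have m0 := expR_ge0 (- nu * t).
have g0 := gronwall_const_ge0.
rewrite -(ler_pM2l c00); apply: le_trans (E_ge t t0) _; apply: le_trans G _.
have -> : c0 * (Kd * (D + kap) ^+ 2 * expR (- nu * t)) =
  gronwall_const * ((2 + 2 * H0) * (D + kap) ^+ 2) * expR (- nu * t).
  by rewrite /energy_const; field; lra.
rewrite ler_wpM2r // ler_wpM2l //.
have d2 := sqr_ge0 D; have k2 := sqr_ge0 kap.
have dk : 0 <= D * kap by rewrite mulr_ge0.
have : 0 <= H0 * kap ^+ 2 by rewrite mulr_ge0 // ltW.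
have : 0 <= H0 * (D * kap) by rewrite mulr_ge0 // ltW.
rewrite -/(E 0) sqrrD mulr2n; lra.
Qed.


(** The root of [energy_decay], with [1 + Kd] in place of the root of [Kd]. The rate is halved but
    stays integrable in time, which is what the means require. *)
Let L1_decay (w : R -> R) (t : R) : 0 <= t -> continuous w ->
  (forall x, w x ^+ 2 <= p t x ^+ 2 + q t x ^+ 2) ->
  \int[mu_]_(x in I) `|w x| <= (1 + Kd) * (D + kap) * expR (- (nu / 2) * t).
Proof.
move=> t0 cw hw; have K0 := energy_const_ge0.
have iw := continuous_integrable cw.
have iw2 : mu_.-integrable I (EFin \o (fun x => w x ^+ 2)).
  by apply: continuous_integrable; exact: contX.
have ipq : mu_.-integrable I (EFin \o (fun x => p t x ^+ 2 + q t x ^+ 2)).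
  apply: continuous_integrable; apply: contD; apply: contX.
    exact: (continuous_slice2 cp).
  exact: (continuous_slice2 cq).
have DK : 0 <= D + kap by rewrite addr_ge0.
have rhs0 : 0 <= (1 + Kd) * (D + kap) * expR (- (nu / 2) * t).
  by rewrite mulr_ge0 ?expR_ge0 // mulr_ge0 // addr_ge0.
rewrite -(@ler_pXn2r _ 2) ?nnegrE ?Rintegral_ge0 //.
have nw2 : (fun x => `|w x| ^+ 2) = (fun x => w x ^+ 2).
  by apply/funext => x; rewrite real_normK ?num_real.
have h := @Rintegral_sqr_ge R (fun x => `|w x|) (integrable_norm iw).
rewrite nw2 in h; apply: le_trans (h iw2) _.
apply: (@le_trans _ _ (\int[mu_]_(x in I) (p t x ^+ 2 + q t x ^+ 2))).
  exact: le_Rintegral.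
apply: le_trans (energy_decay t0) _.
have -> : - nu * t = - (nu / 2) * t + - (nu / 2) * t by field.
rewrite expRD !exprMn -expr2 ler_wpM2r ?sqr_ge0 // ler_wpM2r ?sqr_ge0 //.
by have := sqr_ge0 Kd; nra.
Qed.

Context (f_le : forall s, `|f s| <= M * `|s|) (f_cont : continuous f)
  (g_cont : continuous g)
  (flux_der : forall x : R, is_derive x 1 (fun s => g s * s) (h x))
  (bUh0 : forall t x, 0 <= t -> 0 <= x <= 1 -> `|Uh 0%N t x| <= N * expR (- mu * t))
  (bVh0 : forall t x, 0 <= t -> 0 <= x <= 1 -> `|Vh 0%N t x| <= N * expR (- mu * t))
  (u0_le : `|\int[mu_]_(x in I) (U 0%N 0 x - Uh 0%N 0 x)| <= D)
  (v0_le : `|\int[mu_]_(x in I) (V 0%N 0 x - Vh 0%N 0 x)| <= D).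

Let phi t x := U 0%N t x - Uh 0%N t x.
Let psi t x := V 0%N t x - Vh 0%N t x.

Let cphi : continuous (fun z : R * R => phi z.1 z.2).
Proof. by apply: contD; [exact: cU|apply: contN; exact: cUh]. Qed.
Let cpsi : continuous (fun z : R * R => psi z.1 z.2).
Proof. by apply: contD; [exact: cV|apply: contN; exact: cVh]. Qed.

(** Integral of [(1 + Kd) * expR (- (nu / 2) * t)] over all times. *)
Definition tail_const : R := 2 * (1 + Kd) / nu.

Let DK_ge0 : 0 <= D + kap.
Proof. by rewrite addr_ge0. Qed.

Let decay_le (t : R) : 0 <= t -> expR (- mu * t) <= expR (- (nu / 2) * t).
Proof.
move=> t0; have [nu0 numu _] := rateP; rewrite ler_expR; nra.
Qed.

Let from_mean (w w1 : R -> R) (t x : R) : 0 <= t -> continuous w -> continuous w1 ->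
  (forall x : R, 0 < x < 1 -> is_derive x 1 w (w1 x)) ->
  (forall x, w1 x ^+ 2 <= p t x ^+ 2 + q t x ^+ 2) -> 0 < x < 1 ->
  `|w x| <= `|\int[mu_]_(y in I) w y| + (1 + Kd) * (D + kap).
Proof.
move=> t0 cw cw1 dw hw x01; apply: le_trans (mean_oscillation cw cw1 dw x01) _.
rewrite lerD2l; apply: le_trans (L1_decay t0 cw1 hw) _.
have [nu0 _ _] := rateP; have K0 := energy_const_ge0.
rewrite ler_piMr //; first by rewrite mulr_ge0 // addr_ge0.
by rewrite -expR0 ler_expR mulNr oppr_le0 mulr_ge0 // divr_ge0 // ltW.
Qed.

Definition phi_const : R := 1 + tail_const + (1 + Kd).

(** The time derivative of the mean is minus the integral of q, integrable over all times; hence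
    [barrier] with [lam = 0]. *)
Let phi_bound (t x : R) : 0 <= t -> 0 < x < 1 -> `|phi t x| <= phi_const * (D + kap).
Proof.
move=> t0 x01; have [nu0 _ _] := rateP; have K0 := energy_const_ge0.
have nu2 : 0 < nu / 2 by rewrite divr_gt0.
have m_bound : `|\int[mu_]_(y in I) phi t y| <= D + tail_const * (D + kap).
  have -> : tail_const * (D + kap) = (1 + Kd) * (D + kap) / (nu / 2).
    by rewrite /tail_const; field; lra.
  apply: (@le_trans _ _ (`|\int[mu_]_(y in I) phi 0 y| + 0 +
      (1 + Kd) * (D + kap) / (nu / 2))); last by rewrite addr0 lerD2r.
  have hb : 0 <= (1 + Kd) * (D + kap) by rewrite mulr_ge0 // addr_ge0.
  have hd (s : R) : 0 < s -> is_derive s 1 (fun s => \int[mu_]_(y in I) phi s y)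
      (\int[mu_]_(y in I) - q s y).
    move=> s0; apply: (is_derive_integral (B := fun s y => - q s y) s0 cphi).
      by apply: contN; exact: cq.
    move=> s1 y s10 y01; have := is_deriveB (cs_U0t sol s10 y01) (cs_U0t solh s10 y01).
    by rewrite -opprD.
  have hle (s : R) : 0 < s -> `|\int[mu_]_(y in I) - q s y + 0 * \int[mu_]_(y in I) phi s y|
      <= 0 * 0 + (1 + Kd) * (D + kap) * expR (- (nu / 2) * s).
    move=> s0; rewrite !mul0r addr0 add0r.
    have cqs : continuous (fun y => - q s y) by apply: contN; exact: (continuous_slice2 cq).
    apply: le_trans (le_normr_Rintegral measurable_I01 (continuous_integrable cqs)) _.
    by apply: L1_decay cqs _; [exact: ltW|move=> y; rewrite sqrrN lerDr sqr_ge0].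
  exact: (barrier (lexx 0) (lexx 0) hb nu2 (continuous_integral cphi) hd hle t0).
have cps : continuous (p t) by exact: (continuous_slice2 cp).
have cphis : continuous (phi t) by exact: (continuous_slice2 cphi).
have dphi (y : R) : 0 < y < 1 -> is_derive y 1 (phi t) (p t y).
  move=> y01; exact: (is_deriveB (cs_Ux (i := 0) sol t isT y01) (cs_Ux (i := 0) solh t isT y01)).
have hp (y : R) : p t y ^+ 2 <= p t y ^+ 2 + q t y ^+ 2 by rewrite lerDl sqr_ge0.
apply: le_trans (from_mean t0 cphis cps dphi hp x01) _.
rewrite /phi_const; have := kap_ge0; lra.
Qed.

(** The summands stand for the initial mean, the level at which f(u)/tau balances the damping, the
    time integral of the decaying forcing, and the oscillation about the mean. *)
Definition psi_const : R :=
  1 + M * phi_const + 2 * ((M + 1) * N + H0 * (1 + Kd)) / nu + (1 + Kd).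

Let flux_lip (s s1 : R) : `|s| <= N -> `|s1| <= N ->
  `|g s * s - g s1 * s1| <= H0 * `|s - s1|.
Proof.
move=> sN sN1; have := @le_increment R (fun s => g s * s) h s1 (s - s1) H0.
rewrite [s1 + _]addrC subrK; apply => y hy //.
rewrite ger0_norm; last by apply: le_trans (h_ge y); exact: ltW.
apply: h_le; have := ler_normD (y - s1) s1; rewrite subrK; have := ler_normB s s1; lra.
Qed.

Let psi_bound (t x : R) : 0 <= t -> 0 < x < 1 -> `|psi t x| <= psi_const * (D + kap).
Proof.
move=> t0 x01; have [nu0 _ _] := rateP; have K0 := energy_const_ge0.
have nu2 : 0 < nu / 2 by rewrite divr_gt0.
have H00 := H0_gt0; have M0 := M_ge0; have N0 := N_ge0; have k0 := kap_ge0.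
have P0 : 0 <= phi_const.
  by rewrite /phi_const /tail_const !addr_ge0 // divr_ge0 ?(ltW nu0) // mulr_ge0 // addr_ge0.
(* The term with factor 0 is the source of the profile in the form of [cs_V0t]. *)
pose J s y := kap * (f (U 0%N s y) - V 0%N s y) - g (U 1%N s y) * U 1%N s y -
  (0 * (f (Uh 0%N s y) - Vh 0%N s y) - g (Uh 1%N s y) * Uh 1%N s y).
have cJ : continuous (fun z : R * R => J z.1 z.2).
  have c0 := cU (isT : (0 < 3)%N); have c1 := cU (isT : (1 < 3)%N).
  have d0 := cV (isT : (0 < 3)%N); have d1 := cVh (isT : (0 < 3)%N).
  have c2 := cUh (isT : (0 < 3)%N); have c3 := cUh (isT : (1 < 3)%N).
  have e0 := cont_comp f_cont c0; have e1 := cont_comp g_cont c1.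
  have e2 := cont_comp f_cont c2; have e3 := cont_comp g_cont c3.
  by rewrite /J; cont_arith.
have B0 : 0 <= (M + 1) * N + H0 * (1 + Kd).
  by rewrite addr_ge0 // mulr_ge0 ?addr_ge0 // ltW.
have m_bound : `|\int[mu_]_(y in I) psi t y| <=
    D + M * phi_const * (D + kap) + 2 * ((M + 1) * N + H0 * (1 + Kd)) / nu * (D + kap).
  have -> : 2 * ((M + 1) * N + H0 * (1 + Kd)) / nu * (D + kap) =
    ((M + 1) * N + H0 * (1 + Kd)) * (D + kap) / (nu / 2) by field; lra.
  apply: (@le_trans _ _ (`|\int[mu_]_(y in I) psi 0 y| + M * phi_const * (D + kap) +
      ((M + 1) * N + H0 * (1 + Kd)) * (D + kap) / (nu / 2))); last by rewrite !lerD2r.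
  have hMP : 0 <= M * phi_const * (D + kap) by rewrite !mulr_ge0.
  have hb : 0 <= ((M + 1) * N + H0 * (1 + Kd)) * (D + kap) by rewrite mulr_ge0.
  have hd (s : R) : 0 < s -> is_derive s 1 (fun s => \int[mu_]_(y in I) psi s y)
      (\int[mu_]_(y in I) J s y).
    move=> s0; apply: (is_derive_integral s0 cpsi cJ).
    by move=> s1 y s10 y01; exact: (is_deriveB (cs_V0t sol s10 y01) (cs_V0t solh s10 y01)).
  suff hle (s : R) : 0 < s ->
      `|\int[mu_]_(y in I) J s y + kap * \int[mu_]_(y in I) psi s y|
      <= kap * (M * phi_const * (D + kap)) +
        ((M + 1) * N + H0 * (1 + Kd)) * (D + kap) * expR (- (nu / 2) * s).
    exact: (barrier kap_ge0 hMP hb nu2 (continuous_integral cpsi) hd hle t0).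
  move=> s0; have s0' := ltW s0.
    have cJs : continuous (J s) by exact: (continuous_slice2 cJ).
    have cpsis : continuous (psi s) by exact: (continuous_slice2 cpsi).
    have ckp : continuous (fun y => kap * psi s y).
      by apply: contM => //; exact: cont_cst.
    have cT : continuous (fun y => J s y + kap * psi s y) by exact: contD.
    have cps : continuous (fun y => `|p s y|).
      have c : continuous (p s) by exact: (continuous_slice2 cp).
      by move=> y; apply: continuous_comp; [exact: c|exact: norm_continuous].
    rewrite -RintegralZl //; last exact: continuous_integrable.
    rewrite -RintegralD //; try exact: continuous_integrable.
    apply: le_trans (le_normr_Rintegral measurable_I01 (continuous_integrable cT)) _.
    set m := expR (- (nu / 2) * s); have m0 : 0 < m := expR_gt0 _.
    (* The first summand is the persistent part of kap f(u), balanced by the damping; the second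
       comes from uh and vh and decays. *)
    set A := kap * (M * phi_const * (D + kap)) + kap * ((M + 1) * N * m).
    have cA : continuous (fun y : R => A) by exact: cont_cst.
    have cHp : continuous (fun y => H0 * `|p s y|) by apply: contM => //; exact: cont_cst.
    apply: (@le_trans _ _ (\int[mu_]_(y in I) (cst A y + H0 * `|p s y|))).
      apply: le_Rintegral => //.
      - exact/integrable_norm/continuous_integrable.
      - by apply: continuous_integrable; exact: contD.
      move=> y /I01P y01 /=; have y01' : 0 <= y <= 1 by lra.
      (* Adding the damping removes v; only f(u), vh and the difference of the fluxes remain. *)
      have -> : J s y + kap * psi s y = (kap * f (U 0%N s y) - kap * Vh 0%N s y) -
          (g (U 1%N s y) * U 1%N s y - g (Uh 1%N s y) * Uh 1%N s y).
        by rewrite /J /psi; ring.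
      apply: le_trans (ler_normB _ _) _; apply: lerD; last first.
        by apply: flux_lip; apply: decaying_le.
      apply: le_trans (ler_normB _ _) _; rewrite !normrM (ger0_norm k0).
      rewrite /A -!mulrDr ler_wpM2l //.
      have hm : N * expR (- mu * s) <= N * m by rewrite ler_wpM2l // decay_le.
      have h1 := le_trans (bVh0 s0' y01') hm; have h2 := le_trans (bUh0 s0' y01') hm.
      have h3 := phi_bound s0' y01.
      have h4 : `|U 0%N s y| <= phi_const * (D + kap) + N * m.
        have := ler_normD (phi s y) (Uh 0%N s y); rewrite /phi subrK -/(phi s y); lra.
      have h5 := le_trans (f_le _) (ler_wpM2l M0 h4); lra.
    rewrite RintegralD //; try exact: continuous_integrable.
    rewrite Rintegral_I01_cst RintegralZl //; last exact: continuous_integrable.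
    have cps' : continuous (p s) by exact: (continuous_slice2 cp).
    have hL : \int[mu_]_(y in I) `|p s y| <= (1 + Kd) * (D + kap) * m.
      by apply: L1_decay => // y; rewrite lerDl sqr_ge0.
    have hL' := ler_wpM2l (ltW H00) hL.
    (* Decaying forcing proportional to [kap] is also proportional to [D + kap]. *)
    have h6 : kap * ((M + 1) * N * m) <= (D + kap) * ((M + 1) * N * m).
      by rewrite ler_wpM2r ?lerDr // !mulr_ge0 ?addr_ge0 // ltW.
    by rewrite /A; lra.
have cqs : continuous (q t) by exact: (continuous_slice2 cq).
have cpsis : continuous (psi t) by exact: (continuous_slice2 cpsi).
have dpsi (y : R) : 0 < y < 1 -> is_derive y 1 (psi t) (q t y).
  move=> y01; exact: (is_deriveB (cs_Vx (i := 0) sol t isT y01) (cs_Vx (i := 0) solh t isT y01)).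
have hq (y : R) : q t y ^+ 2 <= p t y ^+ 2 + q t y ^+ 2 by rewrite lerDr sqr_ge0.
apply: le_trans (from_mean t0 cpsis cqs dpsi hq x01) _.
rewrite /psi_const; lra.
Qed.

(** Built from [k], [dl], [N], [M], [mu], [H0] and [H1] alone, hence the same for all [tau] and all
    data. *)
Definition profile_const : R := phi_const + psi_const.

Lemma profile_estimate t x : 0 <= t -> 0 < x < 1 ->
  `|U 0%N t x - Uh 0%N t x| <= profile_const * (D + kap) /\
  `|V 0%N t x - Vh 0%N t x| <= profile_const * (D + kap).
Proof.
move=> t0 x01; have h1 := phi_bound t0 x01; have h2 := psi_bound t0 x01.
by rewrite /profile_const mulrDl; split; [|];
  have := normr_ge0 (phi t x); have := normr_ge0 (psi t x); lra.
Qed.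

End Energy.

(** * Growth of the source term *)

Section LipschitzSource.
Context {R : realType}.
Implicit Types (f g : R -> R) (t x A eta L G kap : R).
Notation mu := (@lebesgue_measure R).
Notation I := (@I01 R).

(* Antiderivative of [x (1 - x)^2], which satisfies the compatibility conditions. *)
Definition bump x : R := x ^+ 2 / 2 - 2 * x ^+ 3 / 3 + x ^+ 4 / 4.

Definition bump_jet A eta : jet R := fun i x =>
  match i with
  | 0 => A + eta * bump x
  | 1 => eta * (x - 2 * x ^+ 2 + x ^+ 3)
  | 2 => eta * (1 - 4 * x + 3 * x ^+ 2)
  | 3 => eta * (- 4 + 6 * x)
  | 4 => eta * 6
  | _ => 0
  end.

Lemma is_derive_bump_jet A eta i x :
  is_derive x 1 (bump_jet A eta i) (bump_jet A eta i.+1 x).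
Proof.
case: i => [|[|[|[|[|i]]]]].
- by rewrite /bump_jet /bump; apply: is_derive_eq; rewrite /GRing.scale /=; field.
- by rewrite /bump_jet; apply: is_derive_eq; rewrite /GRing.scale /=; field.
- by rewrite /bump_jet; apply: is_derive_eq; rewrite /GRing.scale /=; field.
- by rewrite /bump_jet; apply: is_derive_eq; rewrite /GRing.scale /=; field.
- exact: is_derive_cst.
- exact: is_derive_cst.
Qed.

Lemma inH_bump_jet k A eta : inH k (bump_jet A eta).
Proof.
have c i : continuous (bump_jet A eta i).
  by move=> x; exact: is_derive_continuous (is_derive_bump_jet A eta i x).
split=> i ik.
- exact/within_L2/continuous_subspaceT.
- by apply: classical_weak_derivative => // x _; exact: is_derive_bump_jet.
- exact: continuous_subspaceT.
Qed.

(** [A] disappears from the derivatives, so smallness of the data is a condition on [eta] alone, at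
    every level [A]. *)
Lemma Hnorm_dx_bump_jet A eta : 0 <= eta ->
  Hnorm 2 (dx (bump_jet A eta)) = eta * Hnorm 2 (dx (bump_jet 0 1)).
Proof.
move=> eta0; rewrite /Hnorm -[in RHS](ger0_norm eta0) -sqrtr_sqr -sqrtrM ?sqr_ge0 //.
congr Num.sqrt; rewrite mulr_sumr; apply: eq_bigr => i _.
rewrite !L2normE -RintegralZl; last 2 first.
- exact: measurable_I01.
- apply: continuous_integrable; apply: contX => x.
  exact: is_derive_continuous (is_derive_bump_jet 0 1 i.+1 x).
apply: eq_Rintegral => x _; rewrite -exprMn /dx; congr (_ ^+ 2).
by case: (i : nat) => [|[|[|[|j]]]] /=; rewrite ?mul1r ?mulr0.
Qed.

Lemma Hnorm_dx_jconst k (c : R) : Hnorm k (dx (jconst c)) = 0.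
Proof.
rewrite /Hnorm big1 ?sqrtr0 // => i _; rewrite L2normE /dx /=.
by under eq_Rintegral do rewrite expr0n /=; exact: Rintegral_I01_cst.
Qed.

(** The double root of x (1 - x)^2 at 1 annihilates u_x and u_xx there, its simple root u_x at 0;
    with v = 0 all compatibility conditions become 0 = 0, whatever [tau]. *)
Lemma P_data_bump f g k tau A eta : P_data f g k tau (bump_jet A eta) (jconst 0).
Proof.
split; rewrite /= ?expr0n ?expr1n /=; try ring.
- by split; [exact: inH_bump_jet|exact: inH_jconst].
Qed.

(* If [f'] were large at [A], a small increment of [u] near [A] would force an
   increment of [v] exceeding its a priori bound. *)
Lemma derive_source_bound f df g k kap L G A eta (sg : R)
    (U V : nat -> R -> R -> R) :
  let d := bump (3 / 4) - bump (1 / 2) in let T := d / (4 * L) in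
  (forall x : R, is_derive x 1 f (df x)) ->
  0 <= kap -> 0 < L -> 0 < eta <= 1 -> sg = 1 \/ sg = -1 ->
  classical_solution f df g kap k U V ->
  (forall t x, 0 <= t -> 0 < x < 1 -> `|U 1%N t x| <= L * eta) ->
  (forall t x, 0 <= t -> 0 < x < 1 -> `|V 1%N t x| <= L * eta) ->
  (forall x, 0 < x < 1 -> U 0%N 0 x = A + eta * bump x) ->
  (forall x, 0 < x < 1 -> V 0%N 0 x = 0) ->
  (forall s, `|s| <= L -> `|g s| <= G) ->
  0 < sg * df A ->
  (forall y, `|y - A| <= eta * (1 + L * T) -> sg * df A / 2 <= sg * df y) ->
  kap * (sg * df A * d / 4 - L) * T <= L + 2 * G * L * T.
Proof.
move=> d T hf kap0 L0 /andP[eta0 eta1] hsg sol bU bV iU iV hg F0 hdf.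
set F := sg * df A in F0 hdf *.
have d0 : 0 < d by rewrite /d /bump; lra.
have T0 : 0 < T by rewrite /T divr_gt0 // mulr_gt0.
(* Up to time [T] each value of u moves by at most [L * eta * T = eta * d / 4], so half of the
   initial gap [eta * d] between [x1] and [x2] survives. *)
have LT : L * T = d / 4 by rewrite /T; field; lra.
pose x1 : R := 1 / 2; pose x2 : R := 3 / 4.
have x1I : 0 < x1 < 1 by rewrite /x1; lra.
have x2I : 0 < x2 < 1 by rewrite /x2; lra.
have nsg : `|sg| = 1 by case: hsg => ->; rewrite ?normrN normr1.
have cU0 x := continuous_slice1 (x := x) (cs_contU sol (isT : (0 < 3)%N)).
have cV0 x := continuous_slice1 (x := x) (cs_contV sol (isT : (0 < 3)%N)).
have e0 : 0 <= L * eta by rewrite mulr_ge0 // ltW.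
have bumpI x : 0 < x < 1 -> `|bump x| <= 1.
  move=> /andP[h1 h2]; rewrite /bump ler_norml; apply/andP; split; nra.
(* Initial deviation at most [eta], displacement at most [L * eta * T]: u stays where f' keeps at
   least half of its value at [A]. *)
have Ubound t x : 0 <= t <= T -> 0 < x < 1 -> `|U 0%N t x - A| <= eta * (1 + L * T).
  move=> /andP[t0 tT] x01.
  have side (c : R) : c = 1 \/ c = -1 -> c * (U 0%N t x - A) <= eta * (1 + L * T).
    move=> hc; have nc : `|c| = 1 by case: hc => ->; rewrite ?normrN normr1.
    pose Y s := c * U 0%N s x - L * eta * s.
    have cY : continuous Y.
      apply: contD; first by apply: contM; [exact: cont_cst|exact: cU0].
      by apply: contN; apply: contM; [exact: cont_cst|exact: cont_id].
    have dY (s : R) : 0 < s < t -> is_derive s 1 Y (c * - V 1%N s x - L * eta).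
      move=> /andP[s0 _]; have h := cs_U0t sol s0 x01.
      by rewrite /Y; apply: is_derive_eq; rewrite /GRing.scale /= mulr1.
    have h : Y t <= Y 0.
      apply: (nonincreasing_itv cY t0 dY) => s /andP[s0 _].
      have := ler_norm (c * - V 1%N s x); rewrite normrM nc mul1r normrN.
      by have := bV s x (ltW s0) x01; lra.
    have hb : c * bump x <= 1.
      by apply: le_trans (ler_norm _) _; rewrite normrM nc mul1r bumpI.
    have := ler_wpM2l (ltW eta0) hb; have := ler_wpM2l e0 tT.
    by move: h; rewrite /Y iU //; lra.
  rewrite ler_norml; apply/andP; split.
    by rewrite lerNl -mulN1r; apply: side; right.
  by rewrite -[leLHS]mul1r; apply: side; left.
have du t : 0 <= t <= T -> eta * d / 2 <= U 0%N t x2 - U 0%N t x1.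
  move=> /andP[t0 tT].
  pose Y s := - (U 0%N s x2 - U 0%N s x1) - 2 * (L * eta) * s.
  have cY : continuous Y.
    apply: contD; first by apply: contN; apply: contD; [exact: cU0|apply: contN; exact: cU0].
    by apply: contN; apply: contM; [exact: cont_cst|exact: cont_id].
  have dY (s : R) : 0 < s < t ->
      is_derive s 1 Y (- (- V 1%N s x2 - - V 1%N s x1) - 2 * (L * eta)).
    move=> /andP[s0 _]; have h1 := cs_U0t sol s0 x1I; have h2 := cs_U0t sol s0 x2I.
    by rewrite /Y; apply: is_derive_eq; rewrite /GRing.scale /= mulr1.
  have h : Y t <= Y 0.
    apply: (nonincreasing_itv cY t0 dY) => s /andP[s0 _].
    have := bV s x1 (ltW s0) x1I; have := bV s x2 (ltW s0) x2I.
    by rewrite !ler_norml; lra.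
  have := ler_wpM2l e0 tT; have -> : L * eta * T = eta * d / 4 by rewrite mulrAC LT; ring.
  by move: h; rewrite /Y !iU // /d /x1 /x2; lra.
have df_ge t : 0 <= t <= T ->
    F * (eta * d) / 4 <= sg * (f (U 0%N t x2) - f (U 0%N t x1)).
  move=> tT; have hu := du t tT; have ed : 0 < eta * d by rewrite mulr_gt0.
  have lt12 : U 0%N t x1 < U 0%N t x2 by lra.
  have b1 := Ubound t x1 tT x1I; have b2 := Ubound t x2 tT x2I.
  have [|y] := @MVT R f df _ _ lt12.
    by apply: continuous_subspaceT => y; exact: is_derive_continuous (hf y).
  rewrite in_itv /= => /andP[y1 y2] ->.
  have hy : `|y - A| <= eta * (1 + L * T) by move: b1 b2; rewrite !ler_norml; lra.
  have h1 := hdf y hy.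
  have h2 : F / 2 * (eta * d / 2) <= sg * df y * (U 0%N t x2 - U 0%N t x1).
    by apply: ler_pM => //; lra.
  by rewrite [leRHS]mulrA; apply: le_trans h2; lra.
pose w t := V 0%N t x2 - V 0%N t x1.
have w_le t : 0 <= t -> `|w t| <= L * eta.
  move=> t0; have := @le_increment R (V 0%N t) (V 1%N t) x1 (x2 - x1) (L * eta).
  have dx : `|x2 - x1| = 1 / 4 by rewrite /x1 /x2 ger0_norm; lra.
  rewrite subrKC dx => h; apply: le_trans (h _ _) _; last by lra.
    move=> y; rewrite ler_norml /x1 => hy; apply: (cs_Vx (i := 0) sol t isT); lra.
  by move=> y; rewrite ler_norml /x1 => hy; apply: bV => //; lra.
(* Lower bound for the growth rate of [sg * w]: relaxation source minus two flux terms. *)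
set c := kap * (F * (eta * d) / 4 - L * eta) - 2 * (G * (L * eta)).
have G_le t x : 0 <= t -> 0 < x < 1 -> `|g (U 1%N t x) * U 1%N t x| <= G * (L * eta).
  move=> t0 x01; have h := bU t x t0 x01; rewrite normrM; apply: ler_pM => //.
  by apply: hg; apply: le_trans h _; rewrite ler_piMr // ltW.
pose Y t := - (sg * w t) + c * t.
have cY : continuous Y.
  apply: contD; last by apply: contM; [exact: cont_cst|exact: cont_id].
  apply: contN; apply: contM; first exact: cont_cst.
  by apply: contD; [exact: cV0|apply: contN; exact: cV0].
pose q t x := g (U 1%N t x) * U 1%N t x.
have dY (s : R) : 0 < s < T -> is_derive s 1 Y
    (- (sg * (kap * (f (U 0%N s x2) - f (U 0%N s x1) - w s) - (q s x2 - q s x1))) + c).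
  move=> /andP[s0 _]; have h1 := cs_V0t sol s0 x1I; have h2 := cs_V0t sol s0 x2I.
  by rewrite /Y /w; apply: is_derive_eq; rewrite /GRing.scale /q /=; ring.
have : Y T <= Y 0.
  apply: (nonincreasing_itv cY (ltW T0) dY) => s /andP[s0 sT].
  have sT' : 0 <= s <= T by rewrite !ltW.
  have h1 := df_ge s sT'; have h2 := w_le s (ltW s0).
  have h3 := G_le s x1 (ltW s0) x1I; have h4 := G_le s x2 (ltW s0) x2I.
  have h5 : sg * w s <= L * eta.
    by apply: le_trans (ler_norm _) _; rewrite normrM nsg mul1r.
  have h6 : sg * (q s x2 - q s x1) <= 2 * (G * (L * eta)).
    apply: le_trans (ler_norm _) _; rewrite normrM nsg mul1r.
    by apply: le_trans (ler_normB _ _) _; rewrite /q; lra.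
  have h7 : F * (eta * d) / 4 - L * eta <=
      sg * (f (U 0%N s x2) - f (U 0%N s x1)) - sg * w s by lra.
  have h8 := ler_wpM2l kap0 h7; rewrite /c; lra.
have w0 : w 0 = 0 by rewrite /w !iV // subrr.
rewrite /Y w0 !mulr0 oppr0 addr0 => hY.
have hw : sg * w T <= L * eta.
  by apply: le_trans (ler_norm _) _; rewrite normrM nsg mul1r w_le // ltW.
have : c * T <= L * eta by lra.
(* Every term is proportional to [eta], which cancels. *)
have -> : c * T = eta * (kap * (F * d / 4 - L) * T - 2 * G * L * T) by rewrite /c; field.
by rewrite [X in _ <= X]mulrC ler_pM2l // lerBlDr.
Qed.

End LipschitzSource.

(** * Convergence to the profile *)

Section Assembly.
Context {R : realType}.
Implicit Types (f g : R -> R) (t x A eta L G kap c : R) (u v : R -> jet R).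
Notation mu := (@lebesgue_measure R).
Notation I := (@I01 R).

Lemma bounded_on_ball (F : R -> R) (N : R) : continuous F ->
  exists2 K, 0 <= K & forall s, `|s| <= N -> `|F s| <= K.
Proof.
move=> cF; have cF2 : continuous (fun z : R * R => F z.1).
  by apply: (cont_comp cF) => z; exact: cvg_fst.
have [K K0 hK] := bounded_rectangle (- N) N cF2.
exists K => // s; rewrite ler_norml => sN.
by apply: (hK s 0) => //; rewrite lexx ler01.
Qed.

Lemma ext_le_Hnorm u i t x : C0H3 u -> (0 < i < 3)%N -> 0 <= t -> 0 <= x <= 1 ->
  `|ext u i t x| <= 2 * Hnorm 2 (dx (u t)).
Proof.
move=> [uH _]; case: i => // i /= i2 t0 x01; rewrite extE //.
exact: (inH_sup_Hnorm (inH_dx (uH t t0)) i2 x01).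
Qed.

(** The decay constant [C] is common to all data, hence to the perturbations of every state [A],
    here at [tau = taus]. Only [eta] depends on [A], through the modulus of continuity of f' there,
    and it does not enter [M]. *)
Lemma source_derivative_bounded f g (k eps1 taus : R) : smooth f -> smooth g ->
  P_constants f g k eps1 taus -> exists2 M, 0 <= M & forall A, `|derive1 f A| <= M.
Proof.
move=> sf sg [eps0 [taus0 [C [sigma [C0 [sigma0 HP]]]]]].
have sf1 := smooth_derive1 sf; have cdf := smooth_continuous sf1.
pose c1 := Hnorm 2 (dx (bump_jet 0 1 : jet R)) + 1.
have c10 : 0 < c1 by rewrite ltr_wpDl // Hnorm_ge0.
(* The 2 is the embedding constant: [L * eta] bounds u_x and v_x at all times. *)
pose L := 2 * C * c1; have L0 : 0 < L by rewrite !mulr_gt0.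
have [G G0 hG] := bounded_on_ball L (smooth_continuous sg).
pose d : R := bump (3 / 4) - bump (1 / 2).
have d0 : 0 < d by rewrite /d /bump; lra.
pose T := d / (4 * L); have T0 : 0 < T by rewrite divr_gt0 // mulr_gt0.
have kap0 : 0 < taus^-1 by rewrite invr_gt0.
(* The conclusion of [derive_source_bound] for [kap = taus^-1], solved for |f'(A)|. *)
pose M := 4 / d * (L + (L / T + 2 * G * L) * taus).
have M0 : 0 <= M.
  have L0' := ltW L0; have T0' := ltW T0; have d0' := ltW d0; have taus0' := ltW taus0.
  have h1 : 0 <= L / T + 2 * G * L.
    apply: addr_ge0; first exact: divr_ge0.
    exact: mulr_ge0 (mulr_ge0 (ler0n _ 2) G0) L0'.
  by rewrite /M; apply: mulr_ge0; [exact: divr_ge0 (ler0n _ 4) d0'|apply: addr_ge0 => //; exact: mulr_ge0].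
exists M => // A; rewrite leNgt; apply/negP => MA.
have [sgn [hsg sgF]] : exists s : R, (s = 1 \/ s = -1) /\ s * derive1 f A = `|derive1 f A|.
  have [h|h] := leP 0 (derive1 f A).
    by exists 1; split; [left|rewrite mul1r ger0_norm].
  by exists (-1); split; [right|rewrite mulN1r ltr0_norm].
have nsg : `|sgn| = 1 by case: hsg => ->; rewrite ?normrN normr1.
set F := `|derive1 f A| in MA sgF.
have F0 : 0 < F by apply: le_lt_trans MA.
have F2 : 0 < F / 2 by rewrite divr_gt0.
have /cvgrPdist_le /(_ _ F2) [r /= r0 hr] := cdf A.
have LT0 : 0 < 1 + L * T by rewrite addr_gt0 // mulr_gt0.
(* The three entries give [eta <= 1], data of size at most [eps1], and values of u within the radius
   [r] where f' varies by at most [F / 2]. *)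
pose eta := Num.min (Num.min 1 (eps1 / c1)) (r / (2 * (1 + L * T))).
have eta0 : 0 < eta by rewrite !lt_min ltr01 !divr_gt0 // mulr_gt0.
have eta1 : eta <= 1 by rewrite !ge_min lexx.
have eta2 : eta * c1 <= eps1 by rewrite -ler_pdivlMr // !ge_min lexx !orbT.
have eta3 : eta * (1 + L * T) < r.
  have : eta * (2 * (1 + L * T)) <= r.
    by rewrite -ler_pdivlMr ?mulr_gt0 // !ge_min lexx !orbT.
  have : 0 < eta * (1 + L * T) by rewrite mulr_gt0.
  lra.
have HE : Hnorm 2 (dx (bump_jet A eta : jet R)) + Hnorm 2 (dx (jconst 0 : jet R)) <= eta * c1.
  by rewrite Hnorm_dx_bump_jet ?(ltW eta0) // Hnorm_dx_jconst addr0 ler_pM2l // lerDl.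
have [u [v [[hsol _] hdec]]] := HP taus _ _ (lexx _) (P_data_bump f g k taus A eta)
  (le_trans HE eta2).
have sol : classical_solution f (derive1 f) g taus^-1 k (ext u) (ext v).
  apply: (global_solution_classical _ _ cdf sg hsol).
    by move=> a b; rewrite /relaxation mulrC.
  by move=> x; exact: smooth_is_derive.
have [hu hv _ hinit _] := hsol.
have dec t : 0 <= t -> 2 * (Hnorm 2 (dx (u t)) + Hnorm 2 (dx (v t))) <= L * eta.
  move=> t0; have e1 : expR (- sigma * t) <= 1.
    by rewrite -expR0 ler_expR mulNr oppr_le0 mulr_ge0 // ltW.
  have CE : 0 <= C * (Hnorm 2 (dx (bump_jet A eta : jet R)) + Hnorm 2 (dx (jconst 0 : jet R))).
    by rewrite mulr_ge0 ?(ltW C0) // addr_ge0 // Hnorm_ge0.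
  have h1 := le_trans (hdec t t0) (ler_wpM2l CE e1).
  have h2 := ler_wpM2l (ltW C0) HE.
  by rewrite mulr1 in h1; rewrite /L; lra.
have h01 x : 0 < x < 1 -> 0 <= x <= 1 by lra.
have bU t x : 0 <= t -> 0 < x < 1 -> `|ext u 1%N t x| <= L * eta.
  move=> t0 /h01 x01; have := ext_le_Hnorm hu (isT : (0 < 1 < 3)%N) t0 x01.
  have := dec t t0; have := Hnorm_ge0 2 (dx (v t)); lra.
have bV t x : 0 <= t -> 0 < x < 1 -> `|ext v 1%N t x| <= L * eta.
  move=> t0 /h01 x01; have := ext_le_Hnorm hv (isT : (0 < 1 < 3)%N) t0 x01.
  have := dec t t0; have := Hnorm_ge0 2 (dx (u t)); lra.
have iU x : 0 < x < 1 -> ext u 0%N 0 x = A + eta * bump x.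
  by move=> /h01 x01; rewrite extE //; have [-> _] := hinit x x01.
have iV x : 0 < x < 1 -> ext v 0%N 0 x = 0.
  by move=> /h01 x01; rewrite extE //; have [_ ->] := hinit x x01.
have near_A y : `|y - A| <= eta * (1 + L * T) -> sgn * derive1 f A / 2 <= sgn * derive1 f y.
  move=> hy; have h : `|derive1 f A - derive1 f y| <= F / 2.
    by apply: hr; rewrite /= distrC; exact: le_lt_trans eta3.
  have : sgn * (derive1 f A - derive1 f y) <= F / 2.
    by apply: le_trans (ler_norm _) _; rewrite normrM nsg mul1r.
  rewrite mulrBr sgF; lra.
have eta01 : 0 < eta <= 1 by rewrite eta0.
have F0' : 0 < sgn * derive1 f A by rewrite sgF.
have := derive_source_bound (fun x => smooth_is_derive x sf) (ltW kap0) L0 eta01 hsg sol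
  bU bV iU iV hG F0' near_A.
rewrite sgF -/d -/T => h.
have h1 : F * d / 4 <= L + (L / T + 2 * G * L) * taus.
  rewrite -lerBlDl -ler_pdivrMr //.
  have h2 : (F * d / 4 - L) / taus * T <= L + 2 * G * L * T.
    by rewrite [_ / taus]mulrC.
  by rewrite -(ler_pdivlMr _ _ T0) [leRHS]mulrDl mulfK ?gt_eqF in h2.
have h2 : F <= M.
  have -> : F = 4 / d * (F * d / 4) by field; lra.
  by rewrite /M ler_wpM2l // divr_ge0 // ltW.
by move: MA; rewrite ltNge h2.
Qed.

Lemma Linfnorm_le (a : R -> R) c : 0 <= c -> (forall x, 0 < x < 1 -> `|a x| <= c) ->
  (Linfnorm a <= c%:E)%E.
Proof.
(* The other branch is the default value 0 of the norm; [0 <= c] also serves outside (0,1), where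
   the restriction vanishes. *)
move=> c0 hc; rewrite /Linfnorm unlock /=; case: ifPn => _; last by rewrite lee_fin.
apply/ess_supP; apply: aeW => x /=; rewrite lee_fin /patch.
case: ifPn => [|_]; last by rewrite normr0.
by rewrite inE => /I01P; exact: hc.
Qed.

Lemma dx_shift (w : jet R) c : dx (w - jconst c) = dx w.
Proof. by apply/funext => i; apply/funext => x; exact: subr0. Qed.

(** The initial condition fixes order zero only; the first derivatives then agree because both are
    classical in the open interval. *)
Lemma ext_derivative_init u (w : jet R) x : C0H3 u -> inH 3 w ->
  (forall y, 0 <= y <= 1 -> u 0 0%N y = w 0%N y) -> 0 < x < 1 -> ext u 1%N 0 x = w 1%N x.
Proof.
move=> hu hw huw x01; have x01' : 0 <= x <= 1 by lra.
have [uH _] := hu; have d1 := inH_classical (uH 0 (lexx 0)) (isT : (1 < 3)%N) x01.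
have d2 := inH_classical hw (isT : (1 < 3)%N) x01.
rewrite extE //; apply: is_derive_unique d1 _.
apply: is_derive_near (_ : 0 < Num.min x (1 - x)) _ d2; first by rewrite lt_min; lra.
by move=> y; rewrite lt_min !ltr_norml => h; rewrite huw //; lra.
Qed.

Lemma ext_derivative_init_L2 u uh (w wh : jet R) : C0H3 u -> C0H3 uh -> inH 3 w -> inH 3 wh ->
  (forall y, 0 <= y <= 1 -> u 0 0%N y = w 0%N y) ->
  (forall y, 0 <= y <= 1 -> uh 0 0%N y = wh 0%N y) ->
  \int[mu]_(x in I) (ext u 1%N 0 x - ext uh 1%N 0 x) ^+ 2 <= Hnorm 1 (w - wh) ^+ 2 /\
  `|\int[mu]_(x in I) (ext u 0%N 0 x - ext uh 0%N 0 x)| <= Hnorm 1 (w - wh).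
Proof.
move=> hu huh hw hwh e1 e2; have hB := inHB hw hwh.
have l2 i : (i <= 3)%N -> L2 ((w - wh) i) by case: hB => h _ _; exact: h.
split.
  apply: (@le_trans _ _ (L2norm ((w - wh) 1%N) ^+ 2)).
    rewrite L2normE le_eqVlt; apply/orP; left; apply/eqP; apply: eq_Rintegral => x.
    rewrite inE => /I01P x01.
    by rewrite (ext_derivative_init hu hw e1 x01) (ext_derivative_init huh hwh e2 x01).
  by rewrite ler_pXn2r ?nnegrE ?L2norm_ge0 ?Hnorm_ge0 //; exact: L2norm_le_Hnorm.
apply: (@le_trans _ _ (L2norm ((w - wh) 0%N))); last exact: L2norm_le_Hnorm.
apply: le_trans (L1_le_L2norm (l2 0%N isT)).
have -> : \int[mu]_(x in I) (ext u 0%N 0 x - ext uh 0%N 0 x) =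
    \int[mu]_(x in I) ((w - wh) 0%N x).
  apply: eq_Rintegral => x; rewrite inE => /I01P x01; have x01' : 0 <= x <= 1 by lra.
  by rewrite !extE // e1 // e2.
exact: (le_normr_Rintegral measurable_I01 (L2_integrable (l2 0%N isT))).
Qed.

(** Identifies the shift constants of the given profile with those for which decay is known. *)
Lemma mean_limit_eq u v (a b : R) :
  (forall t x, 0 <= t -> 0 <= x <= 1 -> u t 0%N x = v t 0%N x) ->
  mean_limit u a -> mean_limit v b -> a = b.
Proof.
move=> uv ha hb; suff hb' : mean_limit u b.
  by apply: (cvg_unique (@Rhausdorff R) ha hb').
apply: cvg_trans hb; apply: near_eq_cvg; near=> t.
apply: eq_Rintegral => x; rewrite inE => /I01P x01; symmetry; apply: uv; last by lra.
by near: t; exact: nbhs_pinfty_ge.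
Unshelve. all: by end_near. Qed.

Lemma ext_le_Hnorm0 u t x : C0H3 u -> 0 <= t -> 0 <= x <= 1 ->
  `|ext u 0%N t x| <= Hnorm 0 (u t) + Hnorm 2 (dx (u t)).
Proof.
move=> [uH _] t0 x01; rewrite extE //.
apply: le_trans (inH_sup (uH t t0) (isT : (0 < 3)%N) x01) _.
by rewrite Hnorm0E lerD2l; exact: (L2norm_le_Hnorm (dx (u t)) (isT : (0 <= 2)%N)).
Qed.

End Assembly.

(** Decay is known for the solutions provided by [P_constants] and [L_constant]. Uniqueness
    identifies their values on [0,1] with those of the given solutions, and the conclusion involves
    nothing else; so the estimate is carried out for the former. *)
Lemma profile_convergence (R : realType) (f g : R -> R) (k eps1 eps2 taus delta : R) :
  smooth f -> smooth g -> 0 < k -> 0 < delta -> (forall s, delta <= g s) ->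
  (forall s, 0 <= derive1 g s * s) -> f 0 = 0 ->
  P_constants f g k eps1 taus -> L_constant g k eps2 ->
  exists2 C : R, 0 < C &
    forall (tau : R) (u0 v0 : jet R) (u v : R -> jet R)
           (uh0 vh0 : jet R) (uh vh : R -> jet R),
      taus <= tau ->
      P_data f g k tau u0 v0 -> P_solution f g k tau u0 v0 u v ->
      shifted_profile g k uh0 vh0 uh vh ->
      Hnorm2 2 (dx u0) (dx uh0) + Hnorm2 2 (dx v0) (dx vh0) <= Num.min eps1 eps2 ->
      forall t : R, 0 <= t ->
        (Linfnorm2 (u t 0%N - uh t 0%N)%R (v t 0%N - vh t 0%N)%R
         <= (C * (Hnorm 1 (u0 - uh0) + Hnorm 1 (v0 - vh0)) + C * tau^-1)%:E)%E.
Proof.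
move=> sf sg k0 delta0 g_ge g'_ge0 f0 hP hL.
have sf1 := smooth_derive1 sf; have cdf := smooth_continuous sf1.
have df (x : R) : is_derive x 1 f (derive1 f x) := smooth_is_derive x sf.
have [M M0 hM] := source_derivative_bounded sf sg hP.
have f_le s : `|f s| <= M * `|s|.
  have := @le_increment R f (derive1 f) 0 s M (fun y _ => df y) (fun y _ => hM y).
  by rewrite add0r f0 subr0.
have [eps10 [taus0 [C1 [sigma [C10 [sigma0 HP]]]]]] := hP.
have [eps20 [C2 [gamma [C20 [gamma0 HL]]]]] := hL.
pose mu := Num.min sigma gamma.
have mu0 : 0 < mu by rewrite lt_min sigma0.
have mus : mu <= sigma by rewrite ge_min lexx.
have mug : mu <= gamma by rewrite ge_min lexx orbT.
(* One amplitude for both problems; the factors 2 come from the embedding. *)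
pose N := 2 * C1 * eps1 + 2 * C2 * eps2.
have N1 : 0 < 2 * C1 * eps1 by rewrite !mulr_gt0.
have N2 : 0 < 2 * C2 * eps2 by rewrite !mulr_gt0.
have N0 : 0 <= N by rewrite addr_ge0 // ltW.
have [dh cdh hdh] := hfun_C1 sg.
have ch := hfun_continuous sg.
have [H0 H00 hH0] := bounded_on_ball (3 * N) ch.
have [H1 H10 hH1] := bounded_on_ball (3 * N) cdh.
have h_le s : `|s| <= 3 * N -> hfun g s <= H0.
  by move=> hs; apply: le_trans (ler_norm _) (hH0 s hs).
have h_ge s : delta <= hfun g s by have := g_ge s; have := g'_ge0 s; rewrite /hfun; lra.
pose K := @profile_const R k delta N M mu H0 H1.
(* Fixed before [tau] and the data are introduced; the form ensures positivity. *)
exists (`|K| + 1); first by rewrite ltr_wpDl.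
move=> tau u0 v0 u v uh0 vh0 uh vh taule dataP solP shP small t t0.
have tau0 : 0 < tau by exact: lt_le_trans taule.
have kap0 : 0 <= tau^-1 by rewrite invr_ge0 ltW.
have [ub0 [vb0 [ub [vb [us [vs [dataL solL [mu_u mu_v] [euh0 evh0] [euh evh]]]]]]]] := shP.
subst uh0 vh0 uh vh.
rewrite !dx_shift le_min in small; case/andP: small => small1 small2.
have smallP : Hnorm 2 (dx u0) + Hnorm 2 (dx v0) <= eps1.
  by apply: le_trans small1; apply: lerD; exact: Hnorm_le_Hnorm2l.
have smallL : Hnorm 2 (dx ub0) + Hnorm 2 (dx vb0) <= eps2.
  by apply: le_trans small2; apply: lerD; exact: Hnorm_le_Hnorm2r.
have [uP [vP [[solP' uniqP] decP]]] := HP tau u0 v0 taule dataP smallP.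
have [uL [vL [[solL' uniqL] decL [us' [vs' [mean_u mean_v dec0]]]]]] := HL ub0 vb0 dataL smallL.
have agreeP := uniqP u v solP; have agreeL := uniqL ub vb solL.
have -> : us = us'.
  by apply: mean_limit_eq mu_u mean_u => s x s0 x01; have [] := agreeL s x s0 x01.
have -> : vs = vs'.
  by apply: mean_limit_eq mu_v mean_v => s x s0 x01; have [] := agreeL s x s0 x01.
pose uH s := uL s - jconst us'; pose vH s := vL s - jconst vs'.
have solH := global_solution_shift us' vs' solL'.
have sol : classical_solution f (derive1 f) g tau^-1 k (ext uP) (ext vP).
  apply: (global_solution_classical _ df cdf sg solP').
  by move=> a b; rewrite /relaxation mulrC.
have solh : classical_solution f (derive1 f) g 0 k (ext uH) (ext vH).
  by apply: (global_solution_classical _ df cdf sg solH) => a b; rewrite mul0r.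
have [huP hvP _ initP _] := solP'; have [huH hvH _ initH _] := solH.
have [[Hu0 Hv0] _ _ _ _] := dataP; have [[Hub0 Hvb0] _ _ _ _] := dataL.
have exp_le (c s : R) : mu <= c -> 0 <= s -> expR (- c * s) <= expR (- mu * s).
  by move=> h s0; rewrite ler_expR !mulNr lerN2 ler_wpM2r.
have decP' s : 0 <= s -> 2 * (Hnorm 2 (dx (uP s)) + Hnorm 2 (dx (vP s))) <= N * expR (- mu * s).
  move=> s0; have e0 := expR_gt0 (- mu * s).
  have h1 := ler_wpM2l (ltW C10) smallP.
  have C0 : 0 <= C1 * (Hnorm 2 (dx u0) + Hnorm 2 (dx v0)).
    by rewrite mulr_ge0 ?(ltW C10) // addr_ge0 // Hnorm_ge0.
  have h2 := le_trans (decP s s0) (ler_wpM2l C0 (exp_le _ _ mus s0)).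
  have h3 := ler_wpM2r (ltW e0) h1.
  have : 0 <= 2 * C2 * eps2 * expR (- mu * s) by rewrite mulr_ge0 // ltW.
  by rewrite /N; lra.
(* The first bound serves the derivatives; the second serves order zero, where the L^2 decay of the
   shifted profile is needed as well. *)
have decL' s : 0 <= s ->
    2 * (Hnorm 2 (dx (uH s)) + Hnorm 2 (dx (vH s))) <= N * expR (- mu * s) /\
    (Hnorm 0 (uH s) + Hnorm 0 (vH s)) + (Hnorm 2 (dx (uH s)) + Hnorm 2 (dx (vH s)))
      <= N * expR (- mu * s).
  move=> s0; have e0 := expR_gt0 (- mu * s).
  have h1 := ler_wpM2l (ltW C20) smallL.
  have C0 : 0 <= C2 * (Hnorm 2 (dx ub0) + Hnorm 2 (dx vb0)).
    by rewrite mulr_ge0 ?(ltW C20) // addr_ge0 // Hnorm_ge0.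
  have h2 := le_trans (decL s s0) (ler_wpM2l C0 (exp_le _ _ mug s0)).
  have h3 := ler_wpM2r (ltW e0) h1.
  have h4 : 0 <= 2 * C1 * eps1 * expR (- mu * s) by rewrite mulr_ge0 // ltW.
  rewrite /uH /vH !dx_shift; split; first by rewrite /N; lra.
  have Z0 : Hnorm 0 (dx ub0) + Hnorm 0 (dx vb0) <= Hnorm 2 (dx ub0) + Hnorm 2 (dx vb0).
    by rewrite !Hnorm0E; apply: lerD; exact: L2norm_le_Hnorm.
  have Z1 := ler_wpM2l (ltW C20) Z0.
  have C0' : 0 <= C2 * (Hnorm 0 (dx ub0) + Hnorm 0 (dx vb0)).
    by rewrite mulr_ge0 ?(ltW C20) // addr_ge0 // Hnorm_ge0.
  have h5 := le_trans (dec0 s s0) (ler_wpM2l C0' (exp_le _ _ mug s0)).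
  have h6 := ler_wpM2r (ltW e0) Z1.
  by rewrite /N; lra.
have bU : @decaying R N mu (ext uP).
  move=> i s x i3 s0 x01; apply: le_trans (ext_le_Hnorm huP i3 s0 x01) _.
  by have := decP' s s0; have := Hnorm_ge0 2 (dx (vP s)); lra.
have bV : @decaying R N mu (ext vP).
  move=> i s x i3 s0 x01; apply: le_trans (ext_le_Hnorm hvP i3 s0 x01) _.
  by have := decP' s s0; have := Hnorm_ge0 2 (dx (uP s)); lra.
have bUh : @decaying R N mu (ext uH).
  move=> i s x i3 s0 x01; apply: le_trans (ext_le_Hnorm huH i3 s0 x01) _.
  by have [+ _] := decL' s s0; have := Hnorm_ge0 2 (dx (vH s)); rewrite /uH; lra.
have bUh0 s x : 0 <= s -> 0 <= x <= 1 -> `|ext uH 0%N s x| <= N * expR (- mu * s).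
  move=> s0 x01; apply: le_trans (ext_le_Hnorm0 huH s0 x01) _.
  have [_] := decL' s s0; have := Hnorm_ge0 2 (dx (vH s)); have := Hnorm_ge0 0 (vH s).
  by rewrite /uH; lra.
have bVh0 s x : 0 <= s -> 0 <= x <= 1 -> `|ext vH 0%N s x| <= N * expR (- mu * s).
  move=> s0 x01; apply: le_trans (ext_le_Hnorm0 hvH s0 x01) _.
  have [_] := decL' s s0; have := Hnorm_ge0 2 (dx (uH s)); have := Hnorm_ge0 0 (uH s).
  by rewrite /vH; lra.
set uh0 := ub0 - jconst us'; set vh0 := vb0 - jconst vs'.
have Huh0 : inH 3 uh0 by exact: inHB Hub0 (inH_jconst _ _).
have Hvh0 : inH 3 vh0 by exact: inHB Hvb0 (inH_jconst _ _).
pose D := Hnorm 1 (u0 - uh0) + Hnorm 1 (v0 - vh0).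
have Du : Hnorm 1 (u0 - uh0) <= D by rewrite lerDl Hnorm_ge0.
have Dv : Hnorm 1 (v0 - vh0) <= D by rewrite lerDr Hnorm_ge0.
have D0 : 0 <= D by rewrite addr_ge0 // Hnorm_ge0.
have [iu1 iu2] : \int[lebesgue_measure]_(x in I01) (ext uP 1%N 0 x - ext uH 1%N 0 x) ^+ 2
      <= Hnorm 1 (u0 - uh0) ^+ 2 /\
    `|\int[lebesgue_measure]_(x in I01) (ext uP 0%N 0 x - ext uH 0%N 0 x)| <= Hnorm 1 (u0 - uh0).
  apply: ext_derivative_init_L2 => // y y01; first by have [] := initP y y01.
  by have [] := initH y y01.
have [iv1 iv2] : \int[lebesgue_measure]_(x in I01) (ext vP 1%N 0 x - ext vH 1%N 0 x) ^+ 2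
      <= Hnorm 1 (v0 - vh0) ^+ 2 /\
    `|\int[lebesgue_measure]_(x in I01) (ext vP 0%N 0 x - ext vH 0%N 0 x)| <= Hnorm 1 (v0 - vh0).
  apply: ext_derivative_init_L2 => // y y01; first by have [] := initP y y01.
  by have [] := initH y y01.
have sq_le (a : R) : 0 <= a -> a <= D -> a ^+ 2 <= D ^+ 2.
  by move=> a0 aD; rewrite ler_pXn2r ?nnegrE.
have est := profile_estimate k0 delta0 N0 M0 mu0 H10 h_ge ch hdh cdh hH1 h_le cdf hM kap0
  sol solh bU bV bUh D0
  (le_trans iu1 (sq_le _ (Hnorm_ge0 _ _) Du)) (le_trans iv1 (sq_le _ (Hnorm_ge0 _ _) Dv))
  f_le (smooth_continuous sf) (smooth_continuous sg) (fun x : R => is_derive_flux x sg)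
  bUh0 bVh0 (le_trans iu2 Du) (le_trans iv2 Dv) t0.
have DK0 : 0 <= D + tau^-1 by rewrite addr_ge0.
have KD : K * (D + tau^-1) <= (`|K| + 1) * D + (`|K| + 1) * tau^-1.
  rewrite -mulrDr ler_wpM2r //; have := ler_norm K; lra.
have R0 : 0 <= (`|K| + 1) * D + (`|K| + 1) * tau^-1.
  by rewrite -mulrDr mulr_ge0 // addr_ge0.
rewrite /Linfnorm2 ge_max; apply/andP; split; apply: Linfnorm_le => // x x01;
  have x01' : 0 <= x <= 1 by lra.
- have [h _] := est x x01; apply: le_trans KD; apply: le_trans h.
  rewrite !extE // le_eqVlt; apply/orP; left; apply/eqP; congr (`|_|).
  have [e1 _] := agreeP t x t0 x01'; have [e2 _] := agreeL t x t0 x01'.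
  by rewrite /uH -e1; congr (_ - _); exact: (congr1 (fun z => z - us') e2).
- have [_ h] := est x x01; apply: le_trans KD; apply: le_trans h.
  rewrite !extE // le_eqVlt; apply/orP; left; apply/eqP; congr (`|_|).
  have [_ e1] := agreeP t x t0 x01'; have [_ e2] := agreeL t x t0 x01'.
  by rewrite /vH -e1; congr (_ - _); exact: (congr1 (fun z => z - vs') e2).
Qed.

Theorem theorem2p4 (R : realType) (f g : R -> R) (k eps1 eps2 taus : R)
  (smooth_f : smooth f) (smooth_g : smooth g) (k_gt0 : 0 < k)
  (g_ge : exists2 delta : R, 0 < delta & forall s : R, delta <= g s)
  (g'_ge0 : forall s : R, 0 <= derive1 g s * s)
  (f0 : f 0 = 0)
  (hP : P_constants f g k eps1 taus)
  (hL : L_constant g k eps2) :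
  exists eps3 : R, [/\ 0 < eps3, eps3 <= Num.min eps1 eps2,
    exists2 C : R, 0 < C &
      forall (tau : R) (u0 v0 : jet R) (u v : R -> jet R)
             (uh0 vh0 : jet R) (uh vh : R -> jet R),
        taus <= tau ->
        P_data f g k tau u0 v0 -> P_solution f g k tau u0 v0 u v ->
        shifted_profile g k uh0 vh0 uh vh ->
        Hnorm2 2 (dx u0) (dx uh0) + Hnorm2 2 (dx v0) (dx vh0) <= eps3 ->
        forall t : R, 0 <= t ->
          (Linfnorm2 (u t 0%N - uh t 0%N)%R (v t 0%N - vh t 0%N)%R
           <= (C * (Hnorm 1 (u0 - uh0) + Hnorm 1 (v0 - vh0)) + C * tau^-1)%:E)%E &
    forall C0 : R, 0 < C0 -> exists2 C : R, 0 < C &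
      forall (tau : R) (u0 v0 : jet R) (u v : R -> jet R)
             (uh0 vh0 : jet R) (uh vh : R -> jet R),
        taus <= tau ->
        P_data f g k tau u0 v0 -> P_solution f g k tau u0 v0 u v ->
        shifted_profile g k uh0 vh0 uh vh ->
        Hnorm2 2 (dx u0) (dx uh0) + Hnorm2 2 (dx v0) (dx vh0) <= eps3 ->
        Hnorm 1 (u0 - uh0) + Hnorm 1 (v0 - vh0) <= C0 * tau^-1 ->
        forall t : R, 0 <= t ->
          (Linfnorm2 (u t 0%N - uh t 0%N)%R (v t 0%N - vh t 0%N)%R
           <= (C * tau^-1)%:E)%E].
Proof.
have [delta delta0 hg] := g_ge.
have [C C0 hC] := profile_convergence smooth_f smooth_g k_gt0 delta0 hg g'_ge0 f0 hP hL.
exists (Num.min eps1 eps2); split => //.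
- by rewrite lt_min; have [-> _] := hP; have [-> _] := hL.
- by exists C.
- move=> C1 C10; exists (C * C1 + C) => [|tau u0 v0 u v uh0 vh0 uh vh h1 h2 h3 h4 h5 h6 t t0].
    by rewrite addr_gt0 // mulr_gt0.
  apply: le_trans (hC tau u0 v0 u v uh0 vh0 uh vh h1 h2 h3 h4 h5 t t0) _.
  by rewrite lee_fin mulrDl lerD2r -mulrA ler_pM2l.
Qed.
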